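(* Let $X$ be a complex manifold. Fix $(p,q)\in(\mathbb{N}\setminus\{0\})^2$. If $$\sum_{\substack{r+s=p+q-1\\ s\geq \min\{p,q\}}} \dim_{\mathbb{C}} H^{r,s}_{\overline{\partial}}(X)=\sum_{\substack{r+s=p+q\\ s\geq\min\{p,q\}+1}} \dim_{\mathbb{C}} H^{r,s}_{\overline{\partial}}(X)=0,$$ then, for any $(h,k)\in(\mathbb{N}\setminus\{0\})^2$ such that $h+k=p+q$ and $\min\{p,q\}\leq h,k\leq\max\{p,q\}$, there is a natural isomorphism $$H^{h,k}_{BC}(X)\simeq H^{p+q}_{dR}(X;\mathbb{C}).$$
   Context: $\mathbb{N}$ includes $0$. For a complex manifold $X$, $\wedge^{r,s}X$ denotes the space of smooth complex-valued $(r,s)$-forms on $X$, with $\wedge^{r,s}X=\{0\}$ if $r\notin\mathbb{N}$ or $s\notin\mathbb{N}$; $d=\partial+\overline{\partial}$. The manifold $X$ is not assumed compact. $H^{r,s}_{\overline{\partial}}(X)$ denotes Dolbeault cohomology and $H^{k}_{dR}(X;\mathbb{C})$ complex-valued de Rham cohomology. The Bott-Chern cohomology is $H^{\bullet,\bullet}_{BC}(X)=\dfrac{\ker\partial\cap\ker\overline{\partial}}{\operatorname{im}\partial\overline{\partial}}$, that is, $H^{r,s}_{BC}(X)=\dfrac{\{\alpha\in\wedge^{r,s}X:\partial\alpha=0=\overline{\partial}\alpha\}}{\partial\overline{\partial}(\wedge^{r-1,s-1}X)}$. The natural map $H^{h,k}_{BC}(X)\to H^{h+k}_{dR}(X;\mathbb{C})$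 is the $\mathbb{C}$-linear map induced by the identity on forms, $[\alpha]_{BC}\mapsto[\alpha]_{dR}$. *)

(* Defs.v *)
From HB Require Import structures.
From mathcomp Require Import all_boot all_order all_algebra.
From mathcomp Require Import generic_quotient ring_quotient.
From mathcomp Require Import all_classical all_reals all_analysis.
From mathcomp Require Import complex.

Set Implicit Arguments.
Unset Strict Implicit.
Unset Printing Implicit Defensive.

Import Order.TTheory GRing.Theory Num.Theory.
Import numFieldNormedType.Exports.
Import Quotient.

Local Open Scope classical_set_scope.
Local Open Scope quotient_scope.
Local Open Scope ring_scope.

(* The vector space Z / (Z :&: B), for two subspaces Z and B of V; in every
   use below B is contained in Z, because the differentials square to 0. *)
Section Subquotient.
Variables (K : nzRingType) (V : lmodType K) (Z B : submodClosed V).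

Record cocycle := Cocycle { cocycle_val : V; _ : cocycle_val \in Z }.
HB.instance Definition _ := [isSub for cocycle_val].
HB.instance Definition _ := [Choice of cocycle by <:].
HB.instance Definition _ := [SubChoice_isSubLmodule of cocycle by <:].

Definition coboundary : {pred cocycle} := fun z => \val z \in B.

Fact coboundary_submod : submod_closed coboundary.
Proof.
split=> [|c x y].
  by rewrite unfold_in /coboundary raddf0 rpred0.
rewrite ![_ \in coboundary]unfold_in /coboundary => Bx By.
by rewrite (_ : \val _ = c *: \val x + \val y) ?rpredD ?rpredZ.
Qed.
HB.instance Definition _ := GRing.isSubmodClosed.Build K cocycle coboundary
  coboundary_submod.

Definition subquot := {quot coboundary}.
HB.instance Definition _ := GRing.Zmodule.on subquot.
HB.instance Definition _ := ZmodQuotient.on subquot.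

Definition class_of (z : cocycle) : subquot := \pi_subquot z.

Definition subquot_scale (c : K) (x : subquot) : subquot :=
  class_of (c *: repr x).

Fact class_ofE x y : (class_of x = class_of y) <-> (\val x - \val y \in B).
Proof.
rewrite -raddfB -[_ \in B]/(coboundary (x - y)) -[coboundary _]/(_ \in coboundary).
by rewrite idealrBE; split => [|/eqP//] h; apply/eqP.
Qed.

Fact class_ofD x y : class_of (x + y) = class_of x + class_of y.
Proof. exact: raddfD. Qed.

Fact class_ofZ c z : class_of (c *: z) = subquot_scale c (class_of z).
Proof.
have zB : \val z - \val (repr (class_of z)) \in B.
  by apply/class_ofE; rewrite /class_of reprK.
by apply/class_ofE; have := rpredZ c zB; rewrite scalerBr.
Qed.

Fact class_ofK x : class_of (repr x) = x. Proof. exact: reprK. Qed.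

Fact subquot_scaleA a b v :
  subquot_scale a (subquot_scale b v) = subquot_scale (a * b) v.
Proof. by rewrite -[v]class_ofK -!class_ofZ scalerA. Qed.

Fact subquot_scale1 : left_id 1 subquot_scale.
Proof. by move=> v; rewrite -[v in LHS]class_ofK -class_ofZ scale1r class_ofK. Qed.

Fact subquot_scaleDr : right_distributive subquot_scale +%R.
Proof.
move=> c u v; rewrite -[u]class_ofK -[v]class_ofK -class_ofD -!class_ofZ.
by rewrite scalerDr class_ofD.
Qed.

Fact subquot_scaleDl v : {morph subquot_scale^~ v : a b / a + b}.
Proof.
move=> a b; rewrite -[v]class_ofK -!class_ofZ.
by rewrite scalerDl class_ofD.
Qed.

HB.instance Definition _ := GRing.Zmodule_isLmodule.Build K subquot
  subquot_scaleA subquot_scale1 subquot_scaleDr subquot_scaleDl.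

End Subquotient.

(* dimension over the complex numbers, possibly +oo *)
Definition cdim (R : realType) (V : lmodType R[i]) : \bar R :=
  ereal_sup [set (m%:R)%:E | m in [set m : nat | exists v : 'I_m -> V,
    forall c : 'I_m -> R[i],
      \sum_(k < m) c k *: v k = 0 -> forall k, c k = 0]].

(* C^n, a point z = x + iy being represented by the pair (x, y). *)
Notation cspace R n := ('rV[R]_n * 'rV[R]_n)%type.

(* inl j stands for z_j and inr j for its conjugate. *)
Notation cindex n := ('I_n + 'I_n)%type.

Section ComplexCalculus.
Variables (R : realType) (n : nat).
Local Notation E := (cspace R n).
Local Notation C := R[i].
Implicit Types (D : set E) (f : E -> C) (z : E) (a : cindex n).

(* iterated directional derivative *)
Definition iter_derive (vs : seq E) (f : E -> R) : E -> R :=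
  foldr (fun v g => 'D_v g) f vs.

Definition smooth_on D (f : E -> R) : Prop :=
  forall (vs : seq E) z, D z -> differentiable (iter_derive vs f) z.

Definition csmooth_on D f : Prop :=
  smooth_on D (fun z => complex.Re (f z)) /\
  smooth_on D (fun z => complex.Im (f z)).

Definition cderive (v : E) f z : C :=
  Complex ('D_v (fun y => complex.Re (f y)) z)
          ('D_v (fun y => complex.Im (f y)) z).

(* d/dz_j = (d/dx_j - i d/dy_j) / 2, d/dzbar_j = (d/dx_j + i d/dy_j) / 2 *)
Definition wirtinger a f z : C :=
  match a with
  | inl j => 2%:R^-1 * (cderive (delta_mx 0 j, 0) f z
                        - 'i%C * cderive (0, delta_mx 0 j) f z)
  | inr j => 2%:R^-1 * (cderive (delta_mx 0 j, 0) f z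
                        + 'i%C * cderive (0, delta_mx 0 j) f z)
  end.

Definition zcoord a z : C :=
  match a with
  | inl j => Complex (z.1 0 j) (z.2 0 j)
  | inr j => Complex (z.1 0 j) (- z.2 0 j)
  end.

(* smooth, with d(tau_j)/dzbar_k = 0 *)
Definition holomorphic_on D (tau : E -> E) : Prop :=
  forall j : 'I_n, csmooth_on D (fun z => zcoord (inl j) (tau z)) /\
    forall (k : 'I_n) z, D z ->
      wirtinger (inr k) (fun y => zcoord (inl j) (tau y)) z = 0.

End ComplexCalculus.

Section NearDifferentiable.
Variables (R : realType) (V W : normedModType R).

Fact near0_differentiable (h : V -> W) x :
  (\near x, h x = 0) -> differentiable h x.
Proof.
move=> h0.
have hx : h x = 0 by exact: nbhs_singleton h0.
suff E : h \o shift x = cst (h x) + \0 +o_ 0 id.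
  apply/diff_locallyP.
  have -> : 'd h x = \0 :> (V -> W) by apply: diff_unique => // y; exact: cvg_cst.
  by split => // y; exact: cvg_cst.
apply/eqaddoP => eps e0; rewrite hx /=.
have : \forall y \near (0:V), h (y + x) = 0.
  by move: h0; rewrite [X in X -> _](near_shift 0) /=; apply: filterS => y; rewrite /= subr0.
apply: filterS => y hy.
by rewrite /= !fctE /= hy -[0 - _]/(0 - (0 + 0 : W)) addr0 subrr normr0 mulr_ge0 // ltW.
Qed.

Fact near_differentiable (f g : V -> W) x :
  (\near x, f x = g x) -> differentiable f x -> differentiable g x.
Proof.
move=> fg df; rewrite -[g](subrK f); apply: differentiableD => //.
apply: near0_differentiable; apply: filterS fg => y; rewrite !fctE => ->.
by rewrite subrr.
Qed.

End NearDifferentiable.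

Section SmoothTheory.
Variables (R : realType) (n : nat).
Local Notation E := (cspace R n).
Local Notation C := R[i].
Variable D : set E.
Hypothesis D_open : open D.

Fact foldr_derive_lin (f g : E -> R) (b : R) vs z :
  smooth_on D f -> smooth_on D g -> D z ->
  iter_derive vs (b *: f + g) z =
  b * iter_derive vs f z + iter_derive vs g z.
Proof.
move=> sf sg; elim: vs z => [//|v vs IH] z Dz /=.
rewrite (@near_eq_derive _ _ _ _ (b *: iter_derive vs f +
    iter_derive vs g)); last first.
  by near=> y; apply: IH; near: y; exact: open_nbhs_nbhs.
have df := diff_derivable (v := v) (sf vs z Dz); have dg := diff_derivable (v := v) (sg vs z Dz).
rewrite deriveD; [| exact: derivableZ | exact: dg].
rewrite deriveZ; [reflexivity | exact: df].
Unshelve. all: by end_near. Qed.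

Fact smooth_lin (f g : E -> R) (b : R) :
  smooth_on D f -> smooth_on D g -> smooth_on D (b *: f + g).
Proof.
move=> sf sg vs z Dz.
apply: (@near_differentiable _ _ _ (b *: iter_derive vs f +
    iter_derive vs g)).
  near=> y; apply/esym/foldr_derive_lin => //.
  by near: y; exact: open_nbhs_nbhs.
by apply: differentiableD; [apply: differentiableZ; exact: sf | exact: sg].
Unshelve. all: by end_near. Qed.

Fact smooth_eq (f g : E -> R) :
  {in D, f =1 g} -> smooth_on D f -> smooth_on D g.
Proof.
move=> fg sf vs z Dz.
have E1 y : D y ->
    iter_derive vs f y = iter_derive vs g y.
  elim: vs y => [y /mem_set/fg//|v vs IH] y Dy /=.
  apply: near_eq_derive; near=> t; apply: IH.
  by near: t; exact: open_nbhs_nbhs.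
apply: near_differentiable (sf vs z Dz); near=> y; apply: E1.
by near: y; exact: open_nbhs_nbhs.
Unshelve. all: by end_near. Qed.

Fact smooth0 : smooth_on D (0 : E -> R).
Proof.
move=> vs z _; suff -> : iter_derive vs (0 : E -> R) = cst 0.
  exact: differentiable_cst.
by elim: vs => [//|v vs /= ->]; apply/funext => y; rewrite derive_cst.
Qed.

Fact smooth_derive v (f : E -> R) : smooth_on D f -> smooth_on D ('D_v f).
Proof.
by move=> sf vs z Dz; have := sf (rcons vs v) z Dz; rewrite /iter_derive foldr_rcons.
Qed.

Fact csmooth_eq (f g : E -> C) :
  {in D, f =1 g} -> csmooth_on D f -> csmooth_on D g.
Proof.
move=> fg [f1 f2]; split; [apply: smooth_eq f1 | apply: smooth_eq f2];
by move=> z Dz; rewrite fg.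
Qed.

Fact csmooth0 : csmooth_on D (0 : E -> C).
Proof. by split; exact: smooth0. Qed.

Fact Re_lin (c : C) (f g : E -> C) :
  (fun z => complex.Re (c * f z + g z)) =
  complex.Re c *: (fun z => complex.Re (f z)) +
  (- complex.Im c *: (fun z => complex.Im (f z)) + (fun z => complex.Re (g z))).
Proof.
apply/funext => z; rewrite !fctE /=.
by case: c (f z) (g z) => [a b] [a1 b1] [a2 b2] /=; rewrite addrA -mulNr.
Qed.

Fact Im_lin (c : C) (f g : E -> C) :
  (fun z => complex.Im (c * f z + g z)) =
  complex.Re c *: (fun z => complex.Im (f z)) +
  (complex.Im c *: (fun z => complex.Re (f z)) + (fun z => complex.Im (g z))).
Proof.
apply/funext => z; rewrite !fctE /=.
by case: c (f z) (g z) => [a b] [a1 b1] [a2 b2] /=; rewrite addrA.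
Qed.

Fact csmooth_lin c (f g : E -> C) : csmooth_on D f -> csmooth_on D g ->
  csmooth_on D (fun z => c * f z + g z).
Proof.
move=> [f1 f2] [g1 g2]; split; rewrite ?Re_lin ?Im_lin;
  by apply: smooth_lin => //; exact: smooth_lin.
Qed.

Fact derive_lin3 (b1 b2 : R) (f1 f2 g : E -> R) v z : D z ->
  smooth_on D f1 -> smooth_on D f2 -> smooth_on D g ->
  'D_v (b1 *: f1 + (b2 *: f2 + g)) z =
  b1 * 'D_v f1 z + (b2 * 'D_v f2 z + 'D_v g z).
Proof.
move=> Dz s1 s2 sg.
have s3 := smooth_lin b2 s2 sg.
have := foldr_derive_lin b1 [:: v] s1 s3 Dz.
by have := foldr_derive_lin b2 [:: v] s2 sg Dz; rewrite /iter_derive /= => ->.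
Qed.

Fact cderive_lin v c (f g : E -> C) z : D z ->
  csmooth_on D f -> csmooth_on D g ->
  cderive v (fun z => c * f z + g z) z = c * cderive v f z + cderive v g z.
Proof.
move=> Dz [f1 f2] [g1 g2]; rewrite /cderive Re_lin Im_lin !derive_lin3 //.
by case: c => [a b] /=; simpc; rewrite !addrA.
Qed.

Fact wirtinger_lin a c (f g : E -> C) z : D z ->
  csmooth_on D f -> csmooth_on D g ->
  wirtinger a (fun z => c * f z + g z) z = c * wirtinger a f z + wirtinger a g z.
Proof.
move=> Dz sf sg; case: a => j; rewrite /wirtinger !cderive_lin // [RHS]addrC;
  rewrite mulrCA -mulrDr; congr (_ * _).
  by rewrite mulrDr mulrBr opprD (mulrCA 'i%C c) addrACA addrC.
by rewrite !mulrDr (mulrCA 'i%C c) addrACA addrC.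
Qed.

Fact csmooth_wirtinger a (f : E -> C) :
  csmooth_on D f -> csmooth_on D (wirtinger a f).
Proof.
move=> [f1 f2].
have sc v : csmooth_on D (cderive v f) by split; exact: smooth_derive.
have sw (b c : C) u v :
    csmooth_on D (fun z => b * (c * cderive u f z + cderive v f z) + 0).
  by apply: csmooth_lin csmooth0; exact: csmooth_lin.
case: a => j; [apply: csmooth_eq (sw 2%:R^-1 (- 'i%C) (0, delta_mx 0 j)
  (delta_mx 0 j, 0)) | apply: csmooth_eq (sw 2%:R^-1 'i%C (0, delta_mx 0 j)
  (delta_mx 0 j, 0))] => z _ /=; rewrite addr0 addrC ?mulNr //.
Qed.

End SmoothTheory.

(* A Hausdorff, second countable space with a holomorphic atlas, of complex
   dimension n, possibly neither compact nor connected.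
   Outside chart_dom i (resp. its image) the values of chart_map i (resp.
   chart_inv i) are irrelevant. *)
Record complexManifold (R : realType) (n : nat) := ComplexManifold {
  points :> topologicalType;
  manifold_hausdorff : hausdorff_space points;
  manifold_second_countable : @second_countable points;
  chart : Type;
  chart_dom : chart -> set points;
  chart_map : chart -> points -> cspace R n;
  chart_inv : chart -> cspace R n -> points;
  chart_dom_open : forall i, open (chart_dom i);
  chart_cover : forall x, exists i, chart_dom i x;
  chart_img_open : forall i, open (chart_map i @` chart_dom i);
  chart_mapK : forall i x, chart_dom i x -> chart_inv i (chart_map i x) = x;
  chart_map_continuous : forall i, {within chart_dom i, continuous chart_map i};
  chart_inv_continuous :
    forall i, {within chart_map i @` chart_dom i, continuous chart_inv i};
  transition_holomorphic : forall i j,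
    holomorphic_on (chart_map i @` (chart_dom i `&` chart_dom j))
                   (chart_map j \o chart_inv i)
}.

Section Forms.
Variables (R : realType) (n : nat) (X : complexManifold R n).
Local Notation E := (cspace R n).
Local Notation C := R[i].

Definition chart_img (i : chart X) : set E := chart_map i @` chart_dom i.

Definition overlap (i j : chart X) : set E :=
  chart_map i @` (chart_dom i `&` chart_dom j).
Definition transition (i j : chart X) : E -> E := chart_map j \o chart_inv i.

(* A differential form is given in the chart i by its components
     w i z [:: a_1; ...; a_k],
   skew-symmetric in the indices, standing for
     1/k! \sum_(a_1, ..., a_k) w i z [:: a_1; ...; a_k]
                               dzeta_(a_1) /\ ... /\ dzeta_(a_k)
   where zeta_(inl j) = z_j and zeta_(inr j) = conjugate of z_j.
   Forms of all degrees live in the same space; the degree and the bidegree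
   are conditions on the support of the components. They are integers, and
   the only form with a negative degree is 0. *)
Local Notation preform := (chart X -> E -> seq (cindex n) -> C).

Implicit Types (w : preform) (r s k : int).

Record is_form w : Prop := IsForm {
  (* normalization, making equal forms equal as families of components *)
  form_supp : forall i z a, ~ chart_img i z -> w i z a = 0;
  form_smooth : forall i a, csmooth_on (chart_img i) (fun z => w i z a);
  form_skew : forall i z a1 b c a2,
    w i z (a1 ++ b :: c :: a2) = - w i z (a1 ++ c :: b :: a2);
  form_compat : forall i j z a, overlap i j z ->
    w i z a = \sum_(b : (size a).-tuple (cindex n))
      (\prod_(l < size a) wirtinger (tnth (in_tuple a) l)
          (fun y => zcoord (tnth b l) (transition i j y)) z)
      * w j (transition i j z) b
}.

Definition kform k w : Prop :=
  is_form w /\ forall i z a, (size a)%:Z <> k -> w i z a = 0.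

Definition rsform r s w : Prop :=
  is_form w /\ forall i z a,
    ~ ((count is_inl a)%:Z = r /\ (count (predC is_inl) a)%:Z = s) ->
    w i z a = 0.

(* \sum_a dzeta_a /\ d/dzeta_a, for a in P, on components *)
Definition partial_ext (P : pred (cindex n)) w : preform := fun i z a =>
  if z \in chart_img i then
    \sum_(l < size a | P (tnth (in_tuple a) l))
      (-1) ^+ l * wirtinger (tnth (in_tuple a) l)
                    (fun y => w i y (take l a ++ drop l.+1 a)) z
  else 0.

Definition del w : preform := partial_ext is_inl w.
Definition delbar w : preform := partial_ext (predC is_inl) w.
Definition dext w : preform := del w + delbar w.

Definition presmooth w : Prop :=
  forall i a, csmooth_on (chart_img i) (fun z => w i z a).

Fact partial_ext_lin P c u v : presmooth u -> presmooth v ->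
  partial_ext P (c *: u + v) = c *: partial_ext P u + partial_ext P v.
Proof.
move=> su sv; apply/funext => i; apply/funext => z; apply/funext => a.
rewrite -[RHS]/(c * partial_ext P u i z a + partial_ext P v i z a) /partial_ext.
have [/set_mem Dz|_] := boolP (z \in chart_img i); last first.
  rewrite mulr0 addr0; reflexivity.
rewrite mulr_sumr -big_split; apply: eq_bigr => l _.
rewrite [X in _ * X](wirtinger_lin (@chart_img_open R n X i) _ _ Dz) //=.
  by rewrite mulrDr; congr (_ + _); rewrite mulrCA.
  exact: su.
exact: sv.
Qed.

Fact partial_ext_smooth P w : presmooth w -> presmooth (partial_ext P w).
Proof.
move=> sw i a.
have Do : open (chart_img i) := @chart_img_open R n X i.
apply: (@csmooth_eq _ _ _ Do (fun z =>
    \sum_(l < size a | P (tnth (in_tuple a) l))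
      (-1) ^+ l * wirtinger (tnth (in_tuple a) l)
                    (fun y => w i y (take l a ++ drop l.+1 a)) z)).
  by move=> z Dz; rewrite /partial_ext Dz.
elim: (index_enum _) => [|l r IH].
  apply: csmooth_eq (csmooth0 _) => // z _; by rewrite big_nil.
case Pl : (P (tnth (in_tuple a) l)).
  apply: csmooth_eq (csmooth_lin Do ((-1) ^+ l)
    (csmooth_wirtinger Do (tnth (in_tuple a) l)
      (sw i (take l a ++ drop l.+1 a))) IH) => // z _.
  by rewrite big_cons Pl.
by apply: csmooth_eq IH => // z _; rewrite big_cons Pl.
Qed.

Fact is_form0 : is_form (0 : preform).
Proof.
split => //.
- by move=> i a; exact: csmooth0.
- by move=> *; rewrite oppr0.
- by move=> i j z a _; rewrite big1 // => b _; rewrite mulr0.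
Qed.

Fact is_form_lin c u v : is_form u -> is_form v -> is_form (c *: u + v).
Proof.
move=> [u1 u2 u3 u4] [v1 v2 v3 v4]; split.
- by move=> i z a Dz; rewrite !fctE u1 // v1 // scaler0 addr0.
- by move=> i a; exact: (csmooth_lin (@chart_img_open R n X i) c (u2 i a) (v2 i a)).
- by move=> i z a1 b d a2; rewrite !fctE u3 v3 scalerN opprD.
- move=> i j z a o; rewrite !fctE (u4 _ _ _ _ o) (v4 _ _ _ _ o).
  rewrite scaler_sumr -big_split; apply: eq_bigr => b _ /=.
  by rewrite mulrDr; congr (_ + _); rewrite [RHS]mulrCA.
Qed.

Fact kform0 k : kform k 0. Proof. by split => //; exact: is_form0. Qed.

Fact kform_lin k c u v : kform k u -> kform k v -> kform k (c *: u + v).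
Proof.
move=> [fu u0] [fv v0]; split; first exact: is_form_lin.
by move=> i z a h; rewrite !fctE u0 // v0 // scaler0 addr0.
Qed.

Fact rsform0 r s : rsform r s 0. Proof. by split => //; exact: is_form0. Qed.

Fact rsform_lin r s c u v :
  rsform r s u -> rsform r s v -> rsform r s (c *: u + v).
Proof.
move=> [fu u0] [fv v0]; split; first exact: is_form_lin.
by move=> i z a h; rewrite !fctE u0 // v0 // scaler0 addr0.
Qed.

Fact del_lin c u v : presmooth u -> presmooth v ->
  del (c *: u + v) = c *: del u + del v.
Proof. exact: partial_ext_lin. Qed.

Fact delbar_lin c u v : presmooth u -> presmooth v ->
  delbar (c *: u + v) = c *: delbar u + delbar v.
Proof. exact: partial_ext_lin. Qed.

Fact dext_lin c u v : presmooth u -> presmooth v ->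
  dext (c *: u + v) = c *: dext u + dext v.
Proof.
by move=> su sv; rewrite /dext del_lin // delbar_lin // scalerDr addrACA.
Qed.

Fact deldelbar_lin c u v : presmooth u -> presmooth v ->
  del (delbar (c *: u + v)) = c *: del (delbar u) + del (delbar v).
Proof.
by move=> su sv; rewrite delbar_lin // del_lin //; exact: partial_ext_smooth.
Qed.

(* kernel and image of an operator F that is linear on the subspace P *)
Section KerIm.
Variables (P : preform -> Prop) (F : preform -> preform).
Hypothesis P0 : P 0.
Hypothesis Plin : forall c u v, P u -> P v -> P (c *: u + v).
Hypothesis Psmooth : forall u, P u -> presmooth u.
Hypothesis Flin : forall c u v, presmooth u -> presmooth v ->
  F (c *: u + v) = c *: F u + F v.

Fact lin0 : F 0 = 0.
Proof.
have s0 := Psmooth P0.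
have := Flin (-1) s0 s0; rewrite scaler0 addr0 scaleN1r addNr; exact.
Qed.

Fact ker_submod : submod_closed ((fun w => `[< P w /\ F w = 0 >]) : {pred preform}).
Proof.
split=> [|c u v]; rewrite !unfold_in; first by apply/asboolP; rewrite lin0.
move=> /asboolP[Pu Fu] /asboolP[Pv Fv]; apply/asboolP; split; first exact: Plin.
by rewrite Flin ?Fu ?Fv ?scaler0 ?addr0 //; exact: Psmooth.
Qed.

Fact im_submod :
  submod_closed ((fun w => `[< exists2 u, P u & F u = w >]) : {pred preform}).
Proof.
split=> [|c u v]; rewrite !unfold_in.
  by apply/asboolP; exists 0 => //; exact: lin0.
move=> /asboolP[u' Pu <-] /asboolP[v' Pv <-]; apply/asboolP.
exists (c *: u' + v'); first exact: Plin.
apply: Flin; exact: Psmooth.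
Qed.

End KerIm.

Fact kform_smooth k w : kform k w -> presmooth w. Proof. by case=> -[]. Qed.
Fact rsform_smooth r s w : rsform r s w -> presmooth w. Proof. by case=> -[]. Qed.

Definition deRham_ker k : {pred preform} :=
  fun w => `[< kform k w /\ dext w = 0 >].
Definition deRham_im k : {pred preform} :=
  fun w => `[< exists2 u, kform (k - 1) u & dext u = w >].

Definition dolbeault_ker r s : {pred preform} :=
  fun w => `[< rsform r s w /\ delbar w = 0 >].
Definition dolbeault_im r s : {pred preform} :=
  fun w => `[< exists2 u, rsform r (s - 1) u & delbar u = w >].

Definition bottChern_ker r s : {pred preform} :=
  fun w => `[< [/\ rsform r s w, del w = 0 & delbar w = 0] >].
Definition bottChern_im r s : {pred preform} :=
  fun w => `[< exists2 u, rsform (r - 1) (s - 1) u & del (delbar u) = w >].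

Fact deRham_ker_submod k : submod_closed (deRham_ker k).
Proof.
exact: (ker_submod (kform0 k) (@kform_lin k) (@kform_smooth k) dext_lin).
Qed.
HB.instance Definition _ k := GRing.isSubmodClosed.Build C preform
  (deRham_ker k) (deRham_ker_submod k).

Fact deRham_im_submod k : submod_closed (deRham_im k).
Proof.
exact: (im_submod (kform0 _) (@kform_lin _) (@kform_smooth _) dext_lin).
Qed.
HB.instance Definition _ k := GRing.isSubmodClosed.Build C preform
  (deRham_im k) (deRham_im_submod k).

Fact dolbeault_ker_submod r s : submod_closed (dolbeault_ker r s).
Proof.
exact: (ker_submod (rsform0 r s) (@rsform_lin r s) (@rsform_smooth r s)
                   delbar_lin).
Qed.
HB.instance Definition _ r s := GRing.isSubmodClosed.Build C preform
  (dolbeault_ker r s) (dolbeault_ker_submod r s).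

Fact dolbeault_im_submod r s : submod_closed (dolbeault_im r s).
Proof.
exact: (im_submod (rsform0 _ _) (@rsform_lin _ _) (@rsform_smooth _ _)
                  delbar_lin).
Qed.
HB.instance Definition _ r s := GRing.isSubmodClosed.Build C preform
  (dolbeault_im r s) (dolbeault_im_submod r s).

Fact bottChern_ker_submod r s : submod_closed (bottChern_ker r s).
Proof.
have [h0 hlin] := ker_submod (rsform0 r s) (@rsform_lin r s)
  (@rsform_smooth r s) del_lin.
have [k0 klin] := dolbeault_ker_submod r s.
have inP w : (w \in bottChern_ker r s) =
    `[< rsform r s w /\ del w = 0 >] && (w \in dolbeault_ker r s).
  rewrite !unfold_in; apply/asboolP/andP => [[fw dw dbw]|].
    by split; apply/asboolP.
  by move=> [/asboolP[fw dw] /asboolP[_ dbw]].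
split=> [|c u v]; rewrite !inP; first by apply/andP.
move=> /andP[u1 u2] /andP[v1 v2]; apply/andP; split.
  have uv := hlin c u v u1 v1; exact uv.
have uv := klin c u v u2 v2; exact uv.
Qed.
HB.instance Definition _ r s := GRing.isSubmodClosed.Build C preform
  (bottChern_ker r s) (bottChern_ker_submod r s).

Fact bottChern_im_submod r s : submod_closed (bottChern_im r s).
Proof.
exact: (im_submod (rsform0 _ _) (@rsform_lin _ _) (@rsform_smooth _ _)
                  deldelbar_lin).
Qed.
HB.instance Definition _ r s := GRing.isSubmodClosed.Build C preform
  (bottChern_im r s) (bottChern_im_submod r s).

Definition deRham k : lmodType C := subquot (deRham_ker k) (deRham_im k).
Definition dolbeault r s : lmodType C :=
  subquot (dolbeault_ker r s) (dolbeault_im r s).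
Definition bottChern r s : lmodType C :=
  subquot (bottChern_ker r s) (bottChern_im r s).

(* f [alpha]_BC = [alpha]_dR for every alpha; the form underlying both classes
   is the same. *)
Definition induced_by_identity r s k (f : bottChern r s -> deRham k) : Prop :=
  forall alpha : cocycle (bottChern_ker r s),
  exists2 alpha' : cocycle (deRham_ker k),
    \val alpha' = \val alpha & f (class_of _ alpha) = class_of _ alpha'.

End Forms.

(* Main.v *)
(** Write [d = del + delbar] and decompose forms by bidegree.  If [alpha] of type
    [(h, k)] equals [d beta], the vanishing of the Dolbeault groups of total degree
    [h + k - 1] yields, by descending induction on [s] from the type [(0, h + k - 1)]
    down to [s = k], forms [u] with [del beta^(r, s) = del (delbar u)]; complex
    conjugation gives the same for the components with [r >= h], exchanging [del]
    and [delbar].  Hence [alpha = del beta^(h-1, k) + delbar beta^(h, k-1)] is in the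
    image of [del delbar].  In the same way the groups of total degree [h + k] allow
    one to remove, from a closed form, its components with [s > k] and then those
    with [r > h] by adding exact forms, leaving a closed form of type [(h, k)].

    That [del] and [delbar] act on forms given by components in charts rests on the
    commutation of [d] with pullback by the transition maps, where the second
    derivatives of the transitions cancel by skew-symmetry. *)

Require Import Defs.
From HB Require Import structures.
From mathcomp Require Import all_boot all_order all_algebra.
From mathcomp Require Import all_classical all_reals all_analysis.
From mathcomp Require Import complex.
From mathcomp Require Import ring lra zify.

Set Implicit Arguments.
Unset Strict Implicit.
Unset Printing Implicit Defensive.

Import Order.TTheory GRing.Theory Num.Theory.
Import numFieldNormedType.Exports.

Local Open Scope classical_set_scope.
Local Open Scope ring_scope.

(** * Symmetry of mixed second derivatives on a normed space *)

Section SecondDerivatives.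
Variables (R : realType) (V : normedModType R).
Implicit Types (f : V -> R) (u v z : V).

Lemma is_derive_line f u z (s : R) : derivable f (s *: u + z) u ->
  is_derive s 1 (fun t : R => f (t *: u + z)) ('D_u f (s *: u + z)).
Proof.
have E : (fun h : R => h^-1 *: (f ((h *: (1 : R) + s) *: u + z) - f (s *: u + z)))
       = (fun h : R => h^-1 *: (f (h *: u + (s *: u + z)) - f (s *: u + z))).
  by apply/funext => h; rewrite [h *: 1]mulr1 scalerDl addrA.
by move=> df; split; [move: df; rewrite /derivable -E | rewrite /derive -E].
Qed.

Lemma derive_translate f u a z :
  'D_u (fun x => f (x + a)) z = 'D_u f (a + z).
Proof.
rewrite /derive; set F := fun h => _; set G := fun h => _.
suff -> : F = G by [].
by apply/funext => h; rewrite /F /G /= [a + z]addrC addrA.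
Qed.

Lemma mean_value_line f u z (h : R) : 0 < h ->
  (forall s : R, 0 <= s <= h -> differentiable f (s *: u + z)) ->
  exists2 s, 0 < s < h & f (h *: u + z) - f z = h * 'D_u f (s *: u + z).
Proof.
move=> h0 df.
have dF (s : R) : 0 <= s <= h ->
    is_derive s 1 (fun t : R => f (t *: u + z)) ('D_u f (s *: u + z)).
  by move=> /df /diff_derivable dfs; exact: is_derive_line.
have dFo (s : R) : s \in `]0, h[%R ->
    is_derive s 1 (fun t : R => f (t *: u + z)) ('D_u f (s *: u + z)).
  by rewrite in_itv /= => /andP[/ltW a /ltW b]; apply: dF; rewrite a b.
have cF : {within `[0, h], continuous (fun t : R => f (t *: u + z))}.
  apply: derivable_within_continuous => s; rewrite in_itv /= => /dF.
  by case.
have [s] := MVT h0 dFo cF.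
rewrite in_itv /= => sh; rewrite scale0r add0r subr0 => ->.
by exists s; rewrite // mulrC.
Qed.

(** The mean value theorem is applied twice: along [u] to the increment of [f] by [h *: v], then
    along [v] to ['D_u f]. *)
Lemma second_difference f u v z (h : R) : 0 < h ->
  (forall s t : R, 0 <= s <= h -> 0 <= t <= h ->
    differentiable f (t *: v + (s *: u + z)) /\
    differentiable ('D_u f) (t *: v + (s *: u + z))) ->
  exists s t, [/\ 0 < s < h, 0 < t < h &
    f (h *: v + (h *: u + z)) - f (h *: u + z) - (f (h *: v + z) - f z) =
    h * (h * 'D_v ('D_u f) (t *: v + (s *: u + z)))].
Proof.
move=> h0 df; have hh : 0 <= h <= h by rewrite ltW /=.
have h00 : 0 <= (0 : R) <= h by rewrite lexx ltW.
have dshift (s : R) : 0 <= s <= h ->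
    differentiable (f \o shift (h *: v)) (s *: u + z).
  move=> sh; apply: differentiable_comp; first by [].
  by rewrite /= addrC; have [] := df _ _ sh hh.
have df0 (s : R) : 0 <= s <= h -> differentiable f (s *: u + z).
  by move=> sh; have [] := df _ _ sh h00; rewrite scale0r add0r.
have [s sh E] := @mean_value_line (f \o shift (h *: v) - f) u z h h0
  (fun s sh => differentiableB (dshift s sh) (df0 s sh)).
have {}sh' : 0 <= s <= h by case/andP: sh => /ltW -> /ltW ->.
have [t th F] := @mean_value_line ('D_u f) v (s *: u + z) h h0
  (fun t th => proj2 (df _ _ sh' th)).
exists s, t; split=> //; rewrite -F.
have := E; rewrite !fctE /= [h *: u + z + _]addrC [z + _]addrC => ->.
rewrite deriveB; last 2 first.
- exact: (diff_derivable (dshift s sh')).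
- exact: (diff_derivable (df0 s sh')).
by rewrite derive_translate.
Qed.

Lemma near_dist2 (P : V -> Prop) (F G : V -> R) z (e : R) : 0 < e ->
  (\forall y \near z, P y) ->
  {for z, continuous F} -> {for z, continuous G} ->
  exists2 d : R, 0 < d &
    forall y, ball z d y -> [/\ P y, `|F z - F y| < e & `|G z - G y| < e].
Proof.
move=> e0 nP cF cG.
have nF : \forall y \near z, `|F z - F y| < e.
  by move/cvgrPdist_lt: cF; apply.
have nG : \forall y \near z, `|G z - G y| < e.
  by move/cvgrPdist_lt: cG; apply.
have /nbhs_ballP[d /= d0 Hd] : nbhs z (fun y =>
    [/\ P y, `|F z - F y| < e & `|G z - G y| < e]).
  by apply: filterS3 nP nF nG => y.
by exists d.
Qed.

(** Schwarz's theorem. The second difference is symmetric in [u] and [v], so the two mixed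
    derivatives share a value, attained at points close to [z]; continuity at [z] then makes them
    agree there up to any [e]. *)
Lemma derive_comm f u v z :
  (\forall y \near z, [/\ differentiable f y, differentiable ('D_u f) y
     & differentiable ('D_v f) y]) ->
  {for z, continuous ('D_v ('D_u f))} -> {for z, continuous ('D_u ('D_v f))} ->
  'D_v ('D_u f) z = 'D_u ('D_v f) z.
Proof.
move=> df cu cv; apply/eqP; rewrite -subr_eq0 -normr_le0.
apply/ler_addgt0Pl => e e0; rewrite addr0.
have e20 : 0 < e / 2 by rewrite divr_gt0.
have [d d0 Hd] := near_dist2 e20 df cu cv.
(* This size keeps every point [t *: v + (s *: u + z)] with [s, t <= h] in the ball of radius [d];
   the summand [1] makes the denominator positive even if [u = v = 0]. *)
pose h := d / (2 * (`|u| + `|v| + 1)).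
have n0 : 0 < `|u| + `|v| + 1 by rewrite ltr_wpDl // addr_ge0.
have h0 : 0 < h by rewrite divr_gt0 // mulr_gt0.
have inb (s t : R) : 0 <= s <= h -> 0 <= t <= h -> ball z d (t *: v + (s *: u + z)).
  move=> /andP[s0 sh] /andP[t0 th]; rewrite -ball_normE /= /ball_ /=.
  rewrite distrC addrA addrK (le_lt_trans (ler_normD _ _)) //.
  rewrite !normrZ !ger0_norm //.
  have A : t * `|v| <= h * `|v| by rewrite ler_wpM2r.
  have B : s * `|u| <= h * `|u| by rewrite ler_wpM2r.
  apply: le_lt_trans (lerD A B) _.
  have : h * (2 * (`|u| + `|v| + 1)) = d by rewrite /h divfK // gt_eqF // mulr_gt0.
  have := normr_ge0 u; have := normr_ge0 v; nra.
have [s [t [sh th E]]] := @second_difference f u v z h h0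
  (fun s t sh th => let: And3 (And3 a b _) _ _ := Hd _ (inb s t sh th) in conj a b).
have inb' (s' t' : R) : 0 <= s' <= h -> 0 <= t' <= h ->
    ball z d (t' *: u + (s' *: v + z)).
  by move=> a b; rewrite addrCA; exact: inb.
have [s' [t' [sh' th' E']]] := @second_difference f v u z h h0
  (fun s t sh th => let: And3 (And3 a _ b) _ _ := Hd _ (inb' s t sh th) in conj a b).
have lW (a : R) : 0 < a < h -> 0 <= a <= h by case/andP => /ltW -> /ltW ->.
have [_ H1 _] := Hd _ (inb _ _ (lW _ sh) (lW _ th)).
have [_ _ H2] := Hd _ (inb' _ _ (lW _ sh') (lW _ th')).
rewrite [h *: u + (h *: v + z)]addrCA in E'.
move: H1 H2 E E'.
move: ('D_v ('D_u f) (t *: v + _)) ('D_u ('D_v f) (t' *: u + _)) => A B.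
move: ('D_v ('D_u f) z) ('D_u ('D_v f) z) => A' B' HA HB EA EB.
have hn : h != 0 by rewrite gt_eqF.
(* Both are the same second difference divided by the square of [h]. *)
have AB : A = B by apply: (mulfI hn); apply: (mulfI hn); rewrite -EA -EB; ring.
rewrite AB in HA; rewrite distrC in HB.
rewrite [e]splitr -[A'](subrK B) -addrA (le_trans (ler_normD _ _)) //.
by rewrite lerD // ltW.
Qed.

End SecondDerivatives.

(** * Wirtinger calculus for complex-valued functions *)

Section ComplexDifferentiation.
Variables (R : realType) (n : nat).
Local Notation E := (cspace R n).
Local Notation C := R[i].
Implicit Types (f g : E -> C) (z v : E) (a b : cindex n).

(** Differentiability over the reals, the notion under which both kinds of Wirtinger derivatives
    make sense. *)
Definition cdiff f z : Prop :=
  differentiable (fun y => complex.Re (f y)) z /\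
  differentiable (fun y => complex.Im (f y)) z.

Lemma near_eq_comp (T : Type) (h : C -> T) f g z :
  (\near z, f z = g z) -> (\near z, h (f z) = h (g z)).
Proof. by apply: filterS => y ->. Qed.

Lemma eq_derive (F G : E -> R) v z : F =1 G -> 'D_v F z = 'D_v G z.
Proof. by move=> /funext ->. Qed.

Lemma cdiff_cst (c : C) z : cdiff (fun=> c) z.
Proof. by split; exact: differentiable_cst. Qed.

Lemma cdiffD f g z : cdiff f z -> cdiff g z -> cdiff (fun y => f y + g y) z.
Proof.
move=> [f1 f2] [g1 g2]; split.
- rewrite (_ : (fun _ => _) =
    (fun y => complex.Re (f y)) + (fun y => complex.Re (g y))).
    exact: differentiableD.
  by apply/funext => y; rewrite raddfD.
- rewrite (_ : (fun _ => _) =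
    (fun y => complex.Im (f y)) + (fun y => complex.Im (g y))).
    exact: differentiableD.
  by apply/funext => y; rewrite raddfD.
Qed.

Lemma ReM (x y : C) :
  complex.Re (x * y) = complex.Re x * complex.Re y - complex.Im x * complex.Im y.
Proof. by case: x y => [? ?] [? ?]. Qed.

Lemma ImM (x y : C) :
  complex.Im (x * y) = complex.Re x * complex.Im y + complex.Im x * complex.Re y.
Proof. by case: x y => [? ?] [? ?]. Qed.

Lemma ReM_fun f g : (fun y => complex.Re (f y * g y)) =
  (fun y => complex.Re (f y)) * (fun y => complex.Re (g y)) -
  (fun y => complex.Im (f y)) * (fun y => complex.Im (g y)).
Proof. by apply/funext => y; rewrite ReM. Qed.

Lemma ImM_fun f g : (fun y => complex.Im (f y * g y)) =
  (fun y => complex.Re (f y)) * (fun y => complex.Im (g y)) +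
  (fun y => complex.Im (f y)) * (fun y => complex.Re (g y)).
Proof. by apply/funext => y; rewrite ImM. Qed.

Lemma cdiffM f g z : cdiff f z -> cdiff g z -> cdiff (fun y => f y * g y) z.
Proof.
move=> [f1 f2] [g1 g2]; split; rewrite ?ReM_fun ?ImM_fun.
- by apply: differentiableB; exact: differentiableM.
- by apply: differentiableD; exact: differentiableM.
Qed.

Lemma cdiff_sum (I : Type) (r : seq I) (F : I -> E -> C) z :
  (forall e, cdiff (F e) z) -> cdiff (fun y => \sum_(e <- r) F e y) z.
Proof.
move=> dF; elim: r => [|e r IH].
  by rewrite (_ : (fun _ => _) = fun=> 0); [exact: cdiff_cst |
    apply/funext => y; rewrite big_nil].
rewrite (_ : (fun _ => _) = fun y => F e y + \sum_(e <- r) F e y).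
  exact: cdiffD.
by apply/funext => y; rewrite big_cons.
Qed.

Lemma near_eq_cderive v f g z :
  (\near z, f z = g z) -> cderive v f z = cderive v g z.
Proof.
by move=> fg; congr Complex; apply: near_eq_derive; exact: near_eq_comp fg.
Qed.

Lemma cderiveD v f g z : cdiff f z -> cdiff g z ->
  cderive v (fun y => f y + g y) z = cderive v f z + cderive v g z.
Proof.
move=> [f1 f2] [g1 g2].
rewrite -[RHS]/(Complex (_ + _) (_ + _)) /cderive; congr Complex.
  rewrite -deriveD; [|exact: diff_derivable..].
  by apply: eq_derive => y; rewrite raddfD.
rewrite -deriveD; [|exact: diff_derivable..].
by apply: eq_derive => y; rewrite raddfD.
Qed.

Lemma cderiveM v f g z : cdiff f z -> cdiff g z ->
  cderive v (fun y => f y * g y) z = cderive v f z * g z + f z * cderive v g z.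
Proof.
move=> [f1 f2] [g1 g2]; have dd h := @diff_derivable _ _ _ h z v.
rewrite /cderive ReM_fun ImM_fun deriveB; [|apply: derivableM; exact: dd..].
rewrite deriveD; [|apply: derivableM; exact: dd..].
rewrite !deriveM; [|exact: dd..].
move: ('D_v _ z) ('D_v _ z) ('D_v _ z) ('D_v _ z) => a b c d.
case: (f z) (g z) => [x y] [x' y']; rewrite /GRing.scale /=.
by apply/eqP; rewrite eq_complex /=; apply/andP; split; apply/eqP; ring.
Qed.

Lemma cderive_cst v (c : C) z : cderive v (fun=> c) z = 0.
Proof. by rewrite /cderive !derive_cst. Qed.

Lemma cderive_conj v f z : cdiff f z ->
  cderive v (fun y => conjc (f y)) z = conjc (cderive v f z).
Proof.
move=> [f1 f2]; rewrite /cderive /=; congr Complex.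
  by apply: eq_derive => y; case: (f y).
rewrite -deriveN; last exact: diff_derivable.
by apply: eq_derive => y; rewrite fctE /=; case: (f y).
Qed.

Definition xdir a : E :=
  match a with inl j => (delta_mx 0 j, 0) | inr j => (delta_mx 0 j, 0) end.
Definition ydir a : E :=
  match a with inl j => (0, delta_mx 0 j) | inr j => (0, delta_mx 0 j) end.
(** The sign of ['i] is all that distinguishes d/dz from d/dzbar; isolating it lets one computation
    serve both. *)
Definition isgn a : C := if a is inl _ then - 'i%C else 'i%C.

Lemma wirtingerE a f z : wirtinger a f z =
  2%:R^-1 * (cderive (xdir a) f z + isgn a * cderive (ydir a) f z).
Proof. by case: a => j; rewrite //= mulNr. Qed.

Lemma near_eq_wirtinger a f g z :
  (\near z, f z = g z) -> wirtinger a f z = wirtinger a g z.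
Proof. by move=> fg; rewrite !wirtingerE !(near_eq_cderive _ fg). Qed.

Lemma eq_wirtinger a f g z : f =1 g -> wirtinger a f z = wirtinger a g z.
Proof. by move=> /funext ->. Qed.

Lemma wirtinger_cst a (c : C) z : wirtinger a (fun=> c) z = 0.
Proof. by rewrite wirtingerE !cderive_cst mulr0 addr0 mulr0. Qed.

Lemma wirtingerD a f g z : cdiff f z -> cdiff g z ->
  wirtinger a (fun y => f y + g y) z = wirtinger a f z + wirtinger a g z.
Proof.
move=> df dg; rewrite !wirtingerE !(cderiveD _ df dg).
have id4 (k i x y x' y' : C) :
    k * (x + y + i * (x' + y')) = k * (x + i * x') + k * (y + i * y') by ring.
exact: id4.
Qed.

Lemma wirtingerM a f g z : cdiff f z -> cdiff g z ->
  wirtinger a (fun y => f y * g y) z =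
  wirtinger a f z * g z + f z * wirtinger a g z.
Proof.
move=> df dg; rewrite !wirtingerE !(cderiveM _ df dg).
have id4 (k i x y x' y' u w : C) : k * (x * u + w * y + i * (x' * u + w * y')) =
    k * (x + i * x') * u + w * (k * (y + i * y')) by ring.
exact: id4.
Qed.

Lemma wirtingerMl a (c : C) f z : cdiff f z ->
  wirtinger a (fun y => c * f y) z = c * wirtinger a f z.
Proof.
move=> df; rewrite (wirtingerM _ (cdiff_cst c z) df).
by rewrite wirtinger_cst mul0r add0r.
Qed.

Lemma wirtingerN a f z : cdiff f z ->
  wirtinger a (fun y => - f y) z = - wirtinger a f z.
Proof.
move=> df; rewrite -mulN1r -(wirtingerMl _ _ df).
by apply: eq_wirtinger => y; rewrite mulN1r.
Qed.

Lemma wirtinger_sum a (I : Type) (r : seq I) (F : I -> E -> C) z :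
  (forall e, cdiff (F e) z) ->
  wirtinger a (fun y => \sum_(e <- r) F e y) z = \sum_(e <- r) wirtinger a (F e) z.
Proof.
move=> dF; elim: r => [|e r IH].
  rewrite big_nil (_ : (fun _ => _) = fun=> 0) ?wirtinger_cst //.
  by apply/funext => y; rewrite big_nil.
rewrite big_cons -IH -(wirtingerD _ (dF e) (cdiff_sum r dF)).
by apply: eq_wirtinger => y; rewrite big_cons.
Qed.

Definition bar a : cindex n :=
  match a with inl j => inr j | inr j => inl j end.

Lemma barK : involutive bar. Proof. by case. Qed.

(** Real directional derivatives commute with conjugation and 1/2 is real, so only the coefficient
    [isgn] gets conjugated. *)
Lemma wirtinger_conj a f z : cdiff f z ->
  wirtinger a (fun y => conjc (f y)) z = conjc (wirtinger (bar a) f z).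
Proof.
move=> df; rewrite !wirtingerE !(cderive_conj _ df).
have conjE (c i x y : C) :
    conjc (c * (x + i * y)) = conjc c * (conjc x + conjc i * conjc y).
  by rewrite rmorphM rmorphD rmorphM.
have -> : xdir (bar a) = xdir a by case: a.
have -> : ydir (bar a) = ydir a by case: a.
rewrite conjE; have -> : conjc (isgn (bar a)) = isgn a.
  by case: a => j; apply/eqP; rewrite eq_complex /= ?oppr0 ?opprK !eqxx.
by have -> : conjc (2%:R^-1 : C) = 2%:R^-1 by rewrite [LHS]conjc_inv conjc_nat.
Qed.

Lemma zcoord_bar a z : zcoord (bar a) z = conjc (zcoord a z).
Proof. by case: a => j //=; rewrite opprK. Qed.

(** For [f = g + i h] and [zeta = x + i y], this is the identity x f_x + y f_y = zeta f_z +
    conj(zeta) f_zbar. *)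
Lemma real_chain_to_complex (x y gx gy hx hy : R) :
  Complex (x * gx + y * gy) (x * hx + y * hy) =
  Complex x y * (2%:R^-1 * (Complex gx hx - 'i%C * Complex gy hy)) +
  Complex x (- y) * (2%:R^-1 * (Complex gx hx + 'i%C * Complex gy hy)).
Proof.
have -> : (2%:R : C)^-1 = Complex 2^-1 0.
  by rewrite -[RHS]/((2^-1)%:C)%C fmorphV rmorph_nat.
by apply/eqP; rewrite eq_complex /=; apply/andP; split; apply/eqP; field.
Qed.

(** * The chain rule in complex coordinates *)

Section Chain.
Variables (tau : E -> E) (z : E).
Hypothesis tau_diff : forall b, cdiff (fun y => zcoord b (tau y)) z.

(** The map is expanded in the standard real basis; its coefficients are the real and imaginary
    parts of [zcoord (inl j) (tau y)]. *)
Lemma diff_coords : differentiable tau z /\ forall v, 'D_v tau z =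
  \sum_(j < n) ('D_v (fun y => (tau y).1 0 j) z *: ((delta_mx 0 j, 0) : E) +
                'D_v (fun y => (tau y).2 0 j) z *: ((0, delta_mx 0 j) : E)).
Proof.
have d1 j : differentiable (fun y => (tau y).1 0 j) z by case: (tau_diff (inl j)).
have d2 j : differentiable (fun y => (tau y).2 0 j) z by case: (tau_diff (inl j)).
pose F (j : 'I_n) y := (tau y).1 0 j *: ((delta_mx 0 j, 0) : E) +
                (tau y).2 0 j *: ((0, delta_mx 0 j) : E).
have tauE : tau = \sum_(j < n) F j.
  apply/funext => y; rewrite fct_sumE /F; case: (tau y) => t1 t2 /=.
  rewrite [RHS]surjective_pairing; congr (_, _).
    rewrite (big_morph fst (fun _ _ => erefl) erefl) /= [LHS]row_sum_delta.
    by apply: eq_bigr => j _; rewrite scaler0 addr0.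
  rewrite (big_morph snd (fun _ _ => erefl) erefl) /= [LHS]row_sum_delta.
  by apply: eq_bigr => j _; rewrite scaler0 add0r.
have dF j : differentiable (F j) z.
  by apply: differentiableD; exact: differentiableZl.
split; first by rewrite tauE; exact: differentiable_sum.
move=> v; rewrite {1}tauE derive_sum => [|j]; last exact: diff_derivable.
apply: eq_bigr => j _; rewrite deriveD; last 2 first.
- exact/diff_derivable/differentiableZl.
- exact/diff_derivable/differentiableZl.
congr (_ + _); rewrite !deriveE ?diffZl //; exact: differentiableZl.
Qed.

Lemma derive_chain (g : E -> R) v : differentiable g (tau z) ->
  differentiable (fun y => g (tau y)) z /\
  'D_v (fun y => g (tau y)) z =
  \sum_(j < n) ('D_v (fun y => (tau y).1 0 j) z * 'D_(delta_mx 0 j, 0) g (tau z) +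
                'D_v (fun y => (tau y).2 0 j) z * 'D_(0, delta_mx 0 j) g (tau z)).
Proof.
have [dt Et] := diff_coords; move=> dg.
have dgt : differentiable (g \o tau) z by exact: differentiable_comp.
split=> //; rewrite [LHS](deriveE _ dgt) diff_comp //= -(deriveE _ dt) Et linear_sum.
by apply: eq_bigr => j _; rewrite linearD !linearZ /= -!(deriveE _ dg).
Qed.

Lemma cdiff_comp f : cdiff f (tau z) -> cdiff (fun y => f (tau y)) z.
Proof.
by move=> [f1 f2]; split; [have [] := derive_chain 0 f1 |
  have [] := derive_chain 0 f2].
Qed.

(** The formula is first proved for each real direction, with [b] running over coordinates and their
    conjugates; [wirtinger a] is a combination of two such directions. *)
Lemma wirtinger_chain a f : cdiff f (tau z) ->
  wirtinger a (fun y => f (tau y)) z =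
  \sum_b wirtinger a (fun y => zcoord b (tau y)) z * wirtinger b f (tau z).
Proof.
move=> [f1 f2].
have cc v : cderive v (fun y => f (tau y)) z =
    \sum_b cderive v (fun y => zcoord b (tau y)) z * wirtinger b f (tau z).
  rewrite big_sumType /= -big_split /=.
  have [_ E1] := derive_chain v f1; have [_ E2] := derive_chain v f2.
  rewrite /cderive E1 E2.
  have -> (F G : 'I_n -> R) :
      Complex (\sum_j F j) (\sum_j G j) = \sum_j Complex (F j) (G j).
    by elim/big_ind3: _ => // ? ? ? ? ? ? <- <-.
  apply: eq_bigr => j _.
  have d2 : derivable (fun y => (tau y).2 0 j) z v.
    by apply: diff_derivable; case: (tau_diff (inl j)).
  have NE : 'D_v (fun y => complex.Im (zcoord (inr j) (tau y))) z =
      - 'D_v (fun y => (tau y).2 0 j) z by rewrite -deriveN.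
  by rewrite /= in NE; rewrite NE real_chain_to_complex.
rewrite wirtingerE !cc mulr_sumr -big_split mulr_sumr; apply: eq_bigr => b _ /=.
have id3 (k i x y w : C) : k * (x * w + i * (y * w)) = k * (x + i * y) * w by ring.
by rewrite [in RHS]wirtingerE id3.
Qed.

End Chain.

(** * Commutation of derivatives of smooth functions *)

Section Smooth.
Variable D : set E.
Hypothesis D_open : open D.

Lemma csmooth_cdiff f z : csmooth_on D f -> D z -> cdiff f z.
Proof. by move=> [f1 f2] Dz; split; [exact: (f1 [::]) | exact: (f2 [::])]. Qed.

Lemma csmooth_cderive v f : csmooth_on D f -> csmooth_on D (cderive v f).
Proof. by move=> [f1 f2]; split; exact: smooth_derive. Qed.

Lemma smooth_derive_comm (f : E -> R) u v z : smooth_on D f -> D z ->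
  'D_v ('D_u f) z = 'D_u ('D_v f) z.
Proof.
move=> sf Dz; apply: derive_comm.
- have : \forall y \near z, D y by exact: open_nbhs_nbhs.
  by apply: filterS => y Dy; split; [exact: (sf [::]) | exact: (sf [:: u]) |
    exact: (sf [:: v])].
- exact/differentiable_continuous/(sf [:: v; u]).
- exact/differentiable_continuous/(sf [:: u; v]).
Qed.

Lemma cderive_comm f u v z : csmooth_on D f -> D z ->
  cderive v (cderive u f) z = cderive u (cderive v f) z.
Proof.
move=> [f1 f2] Dz.
exact: (f_equal2 (@Complex R) (smooth_derive_comm u v f1 Dz)
                          (smooth_derive_comm u v f2 Dz)).
Qed.

Lemma wirtinger_comm f a b z : csmooth_on D f -> D z ->
  wirtinger a (wirtinger b f) z = wirtinger b (wirtinger a f) z.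
Proof.
move=> sf Dz.
have dc v : cdiff (cderive v f) z by apply: csmooth_cdiff Dz; exact: csmooth_cderive.
have cw c v : cderive v (wirtinger c f) z = 2%:R^-1 *
    (cderive v (cderive (xdir c) f) z + isgn c * cderive v (cderive (ydir c) f) z).
  rewrite (_ : wirtinger c f = fun y => 2%:R^-1 *
    (cderive (xdir c) f y + isgn c * cderive (ydir c) f y)); last first.
    by apply/funext => y; exact: wirtingerE.
  have d1 : cdiff (fun y => isgn c * cderive (ydir c) f y) z.
    by apply: cdiffM; [exact: cdiff_cst | exact: dc].
  rewrite (cderiveM v (cdiff_cst 2%:R^-1 z) (cdiffD (dc (xdir c)) d1)).
  rewrite (cderiveD v (dc (xdir c)) d1).
  rewrite (cderiveM v (cdiff_cst (isgn c) z) (dc (ydir c))).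
  by rewrite !cderive_cst !mul0r !add0r.
rewrite [LHS]wirtingerE [RHS]wirtingerE !cw.
have id4 (k i j x y x' y' x1 y1 x1' y1' : C) :
    x = x1 -> y = x1' -> x' = y1 -> y' = y1' ->
    k * (k * (x + j * y) + i * (k * (x' + j * y'))) =
    k * (k * (x1 + i * y1) + j * (k * (x1' + i * y1'))).
  by move=> -> -> -> ->; ring.
by apply: id4; exact: cderive_comm sf Dz.
Qed.

End Smooth.
End ComplexDifferentiation.

(** * Multilinear algebra of components: pullback by a matrix and exterior product *)

Section Pullback.
Variables (I : finType) (C : comNzRingType).
Implicit Types (J K : I -> I -> C) (W : seq I -> C) (a b : seq I).

Definition skew W : Prop := forall a1 (b c : I) a2,
  W (a1 ++ b :: c :: a2) = - W (a1 ++ c :: b :: a2).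

Lemma skew_cons W e : skew W -> skew (fun b => W (e :: b)).
Proof. by move=> sW a1 b c a2; exact: (sW (e :: a1)). Qed.

(** Pullback of a covariant tensor with components [W] by the matrix [J]. The recursion on the
    indices suits inductive proofs; [pull_tuple] gives the closed form found in [form_compat]. *)
Fixpoint pull J W a : C :=
  if a is c :: a' then \sum_e J c e * pull J (fun b => W (e :: b)) a'
  else W [::].

(** Components of the exterior product of the 1-form [k] with [W], that is the alternating sum over
    the position of the index given to [k]. *)
Fixpoint wedge (k : I -> C) W a : C :=
  if a is x :: a' then k x * W a' - wedge k (fun b => W (x :: b)) a' else 0.

(* derivative of [pull J W a] when J varies with derivative K *)
Fixpoint dpull K J W a : C :=
  if a is x :: a' then
    \sum_e (K x e * pull J (fun b => W (e :: b)) a' +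
            J x e * dpull K J (fun b => W (e :: b)) a')
  else 0.

Lemma pull_lin J k W W' a :
  pull J (fun b => k * W b + W' b) a = k * pull J W a + pull J W' a.
Proof.
elim: a W W' => //= c a IH W W'; rewrite mulr_sumr -big_split.
by apply: eq_bigr => e _ /=; rewrite IH mulrDr mulrCA.
Qed.

Lemma pull0 J a : pull J (fun=> 0) a = 0.
Proof. by elim: a => //= c a IH; rewrite big1 // => e _; rewrite IH mulr0. Qed.

Lemma pullN J W a : pull J (fun b => - W b) a = - pull J W a.
Proof.
have := pull_lin J (- 1) W (fun=> 0) a; rewrite pull0 addr0 mulN1r => <-.
by congr pull; apply/funext => b; rewrite mulN1r addr0.
Qed.

Lemma pullB J W W' a :
  pull J (fun b => W b - W' b) a = pull J W a - pull J W' a.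
Proof.
have := pull_lin J 1 W (fun b => - W' b) a; rewrite pullN mul1r => <-.
by congr pull; apply/funext => b; rewrite mul1r.
Qed.

Lemma wedge0 W a : wedge (fun=> 0) W a = 0.
Proof. by elim: a W => //= x a IH W; rewrite IH mul0r subr0. Qed.

Lemma wedgeN k W a : wedge k (fun b => - W b) a = - wedge k W a.
Proof.
by elim: a W => /= [|x a IH] W; [rewrite oppr0 | rewrite IH; ring].
Qed.

Lemma wedge_sum k (F : I -> C) (W : I -> seq I -> C) a :
  wedge k (fun b => \sum_e F e * W e b) a = \sum_e F e * wedge k (W e) a.
Proof.
elim: a W => /= [|x a IH] W; first by rewrite big1 // => e _; rewrite mulr0.
rewrite IH mulr_sumr -sumrB; apply: eq_bigr => e _; ring.
Qed.

(** The product rule differentiates one slot at a time. Skewness of [W] brings the differentiated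
    slot to the front, with the very sign that [wedge] attaches to its position. *)
Lemma dpull_wedge K J W a : skew W ->
  dpull K J W a =
  \sum_e wedge (fun x => K x e) (pull J (fun b => W (e :: b))) a.
Proof.
elim: a W => /= [|x a IH] W sW; first by rewrite big1.
rewrite sumrB big_split; congr (_ + _).
rewrite -[LHS]opprK; congr (- _).
under [RHS]eq_bigr => e _ do rewrite wedge_sum.
rewrite exchange_big -sumrN; apply: eq_bigr => f _ /=.
rewrite IH; last exact: skew_cons.
rewrite -mulrN -mulr_sumr -sumrN; congr (_ * _); apply: eq_bigr => e _.
rewrite -wedgeN; congr wedge; apply/funext => b; rewrite -pullN /=.
(* Exchanging the two leading indices accounts for the minus sign. *)
by congr (pull J _ b); apply/funext => d; rewrite (sW [::]) opprK.
Qed.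

Lemma pull_tuple J W a : pull J W a =
  \sum_(b : (size a).-tuple I)
    (\prod_(l < size a) J (tnth (in_tuple a) l) (tnth b l)) * W b.
Proof.
elim: a W => /= [|c a IH] W.
  rewrite (big_pred1 [tuple]) ?big_ord0 ?mul1r // => b /=.
  by apply/esym/eqP; exact: tuple0.
under eq_bigr => e _ do rewrite IH mulr_sumr.
rewrite pair_bigA.
rewrite [RHS](reindex (fun p : I * (size a).-tuple I => [tuple of p.1 :: p.2]));
  last first.
  exists (fun t : (size a).+1.-tuple I => (thead t, [tuple of behead t])).
    by move=> [e b] _; congr (_, _); exact: val_inj.
  by move=> t _; rewrite -tuple_eta.
apply: eq_bigr => -[e b] _ /=; rewrite big_ord_recl mulrA; congr (_ * _ * _).
by apply: eq_bigr => l _; congr J; rewrite !(tnth_nth c) //= (tnth_nth c).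
Qed.

(** A matrix that respects the types [phi] mixes only index lists with the same sequence of types.
    Letting [T] read that sequence allows the induction to absorb the head of the list into [T]. *)
Lemma pull_mask (phi : I -> bool) J (T : seq bool -> bool) W a :
  (forall c e, phi c != phi e -> J c e = 0) ->
  pull J (fun b => if T (map phi b) then W b else 0) a =
  if T (map phi a) then pull J W a else 0.
Proof.
move=> J0; elim: a T W => //= c a IH T W.
have E e : J c e * pull J (fun b => if T (phi e :: map phi b)
                                    then W (e :: b) else 0) a =
    if T (phi c :: map phi a)
    then J c e * pull J (fun b => W (e :: b)) a else 0.
  have [->|ne] := eqVneq (phi c) (phi e).
    by rewrite (IH (fun s => T (phi e :: s))); case: ifP; rewrite ?mulr0.
  by rewrite J0 // !mul0r if_same.
by rewrite (eq_bigr _ (fun e _ => E e)); case: ifP => // _; rewrite big1.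
Qed.

End Pullback.

(** * The exterior derivative and its two parts inside one chart *)

Section ExteriorDerivative.
Variables (R : realType) (n : nat).
Local Notation E := (cspace R n).
Local Notation C := R[i].
Local Notation I := (cindex n).
Implicit Types (P Q : pred I) (W : seq I -> E -> C) (a b : seq I) (z : E).

(* the components of [partial_ext P w] in a chart, by Cartan's formula
   [iota_c d = d/dc - d iota_c] for the constant vector field of index c *)
Fixpoint ext P W a z : C :=
  if a is c :: a' then
    (if P c then wirtinger c (W a') z else 0) - ext P (fun b => W (c :: b)) a' z
  else 0.

(** Passing to the tail shifts every position by one, whence the minus sign of the recursion. *)
Lemma extE P W a z : ext P W a z =
  \sum_(l < size a | P (tnth (in_tuple a) l))
    (-1) ^+ l * wirtinger (tnth (in_tuple a) l)
                  (fun y => W (take l a ++ drop l.+1 a) y) z.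
Proof.
elim: a W => /= [|c a IH] W; first by rewrite big_ord0.
rewrite big_mkcond big_ord_recl /= expr0 mul1r drop0; congr (_ + _).
rewrite IH -sumrN big_mkcond /=; apply: eq_bigr => l _.
rewrite !(tnth_nth c) /=; case: ifP => // _.
by rewrite /bump /= add1n exprS mulN1r mulNr.
Qed.

Lemma near_eq_ext P W W' a z : (forall b, \near z, W b z = W' b z) ->
  ext P W a z = ext P W' a z.
Proof.
elim: a W W' => //= c a IH W W' h; rewrite (near_eq_wirtinger _ (h a)).
by rewrite (IH _ (fun b => W' (c :: b))).
Qed.

Lemma eq_ext P W W' a z : (forall b, W b =1 W' b) -> ext P W a z = ext P W' a z.
Proof. by move=> h; congr (ext P _ a z); apply/funext => b; exact/funext. Qed.

Lemma ext0 P a z : ext P (fun=> fun=> 0) a z = 0.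
Proof. by elim: a => //= c a ->; rewrite wirtinger_cst if_same subr0. Qed.

(** The Leibniz rule d(F G) = dF /\ G + F dG, with dF restricted to the indices in [P]. *)
Lemma ext_sum (K : finType) P (F : K -> E -> C) (G : K -> seq I -> E -> C) a z :
  (forall e, cdiff (F e) z) -> (forall e b, cdiff (G e b) z) ->
  ext P (fun b y => \sum_e F e y * G e b y) a z =
  \sum_e (wedge (fun x => if P x then wirtinger x (F e) z else 0)
            (fun b => G e b z) a + F e z * ext P (G e) a z).
Proof.
move=> dF; elim: a G => /= [|c a IH] G dG.
  by rewrite big1 // => e _; rewrite mulr0 addr0.
rewrite IH // wirtinger_sum; last by move=> e; exact: cdiffM.
under [X in (if _ then X else _)]eq_bigr => e _ do
  rewrite (wirtingerM c (dF e) (dG e a)).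
rewrite -sumrN; case: ifP => Pc.
  rewrite -big_split; apply: eq_bigr => e _ /=; ring.
by rewrite add0r; apply: eq_bigr => e _ /=; ring.
Qed.

Lemma extB P W W' a z :
  (forall b, cdiff (W b) z) -> (forall b, cdiff (W' b) z) ->
  ext P (fun b y => W b y - W' b y) a z = ext P W a z - ext P W' a z.
Proof.
elim: a W W' => /= [|c a IH] W W' dW dW'; first by rewrite subr0.
rewrite IH //; case: ifP => _; last by ring.
rewrite (wirtingerD c (dW a)); last first.
  rewrite (_ : (fun _ => _) = fun y => -1 * W' a y).
    by apply: cdiffM => //; exact: cdiff_cst.
  by apply/funext => y; rewrite mulN1r.
by rewrite wirtingerN //; ring.
Qed.

(** When the exchanged indices lead the list, the two derivative terms of the recursion trade places
    with opposite signs, and the remaining term is skew because [W] is. *)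
Lemma skew_ext P W z : (forall y, skew (W^~ y)) ->
  (forall a, cdiff (W a) z) -> skew (fun a => ext P W a z).
Proof.
move=> sW dW a1 b c a2; elim: a1 W sW dW => /= [|x a1 IH] W sW dW.
  have NE : ext P (fun d => W (b :: c :: d)) a2 z =
            - ext P (fun d => W (c :: b :: d)) a2 z.
    rewrite -[RHS]add0r -[X in X - _](ext0 P a2 z) -extB //.
    by apply: eq_ext => d y; rewrite (sW y [::]) sub0r.
  by rewrite NE; ring.
rewrite (IH (fun d => W (x :: d)) (fun y => @skew_cons _ _ _ x (sW y))
  (fun d => dW (x :: d))).
have -> : wirtinger x (W (a1 ++ b :: c :: a2)) z =
         - wirtinger x (W (a1 ++ c :: b :: a2)) z.
  by rewrite -wirtingerN //; apply: eq_wirtinger => y; exact: sW.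
by case: ifP => _; ring.
Qed.

(** * Anticommutation of the partial exterior derivatives *)

Section Commutation.
Variable D : set E.
Hypothesis D_open : open D.

Lemma csmooth_ext P W a : (forall b, csmooth_on D (W b)) ->
  csmooth_on D (ext P W a).
Proof.
elim: a W => /= [|c a IH] W sW; first exact: csmooth0.
pose T := if P c then wirtinger c (W a) else 0.
have sT : csmooth_on D T.
  by rewrite /T; case: ifP => _; [exact: csmooth_wirtinger | exact: csmooth0].
apply: csmooth_eq (csmooth_lin D_open (-1) (IH (fun b => W (c :: b)) _) sT) => //.
by move=> z _ /=; rewrite mulN1r addrC /T; case: ifP.
Qed.

Lemma wirtinger_ext c P W a z : (forall b, csmooth_on D (W b)) -> D z ->
  wirtinger c (ext P W a) z = ext P (fun b => wirtinger c (W b)) a z.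
Proof.
move=> sW Dz; elim: a W sW => /= [|x a IH] W sW; first exact: wirtinger_cst.
have dC f : csmooth_on D f -> cdiff f z by move=> /csmooth_cdiff; apply.
have dext := dC _ (csmooth_ext P a (fun b => sW (x :: b))).
have dw : cdiff (wirtinger x (W a)) z by apply/dC/csmooth_wirtinger.
have dN : cdiff (fun y => - ext P (fun b => W (x :: b)) a y) z.
  rewrite (_ : (fun _ => _) = fun y => -1 * ext P (fun b => W (x :: b)) a y).
    by apply: cdiffM => //; exact: cdiff_cst.
  by apply/funext => y; rewrite mulN1r.
have dT : cdiff (fun y => if P x then wirtinger x (W a) y else 0) z.
  by case: (P x) => //; exact: cdiff_cst.
rewrite (wirtingerD c dT dN) wirtingerN // (IH (fun b => W (x :: b))) //.
congr (_ - _); case: (P x); last exact: wirtinger_cst.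
exact: (wirtinger_comm D_open c x (sW a) Dz).
Qed.

(** On [c :: a] the left side is a [P]-term minus a [Q]-term, both differentiated in [c], plus the
    same expression for [W (c :: _)]. The first two change sign when [P] and [Q] are exchanged, and
    induction handles the third. *)
Lemma ext_anticomm P Q W a z : (forall b, csmooth_on D (W b)) -> D z ->
  ext P (ext Q W) a z = - ext Q (ext P W) a z.
Proof.
move=> sW Dz; elim: a W sW => /= [|c a IH] W sW; first by rewrite oppr0.
have step T T' : ext T (fun b y => ext T' W (c :: b) y) a z =
    (if T' c then wirtinger c (ext T W a) z else 0) -
    ext T (ext T' (fun b => W (c :: b))) a z.
  rewrite /= extB; last 2 first.
  - move=> b; case: (T' c); last exact: cdiff_cst.
    by apply: csmooth_cdiff Dz; exact: csmooth_wirtinger.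
  - by move=> b; apply: csmooth_cdiff Dz; exact: csmooth_ext.
  by congr (_ - _); case: (T' c); rewrite ?ext0 ?wirtinger_ext.
by rewrite !step (IH (fun b => W (c :: b))) //; ring.
Qed.

End Commutation.

(** * Compatibility of the partial exterior derivatives with pullback *)

Section Naturality.
Variables (P : pred I) (tau : E -> E) (z : E).
Let J c e y := wirtinger c (fun x => zcoord e (tau x)) y.
Hypothesis tau_diff : forall c, cdiff (fun y => zcoord c (tau y)) z.
Hypothesis J_diff : forall c e, cdiff (J c e) z.
Hypothesis J_comm : forall x c e,
  (if P x then wirtinger x (J c e) z else 0) =
  (if P c then wirtinger c (J x e) z else 0).
Hypothesis J_pure : forall c e, P c != P e -> J c e z = 0.

(** The first sum comes from the chain rule on the coefficients [W], the [dpull] term from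
    differentiating the Jacobian entries. *)
Lemma pull_cdiff_wirtinger c W a : (forall b, cdiff (W b) (tau z)) ->
  cdiff (fun y => pull (fun x e => J x e y) (fun b => W b (tau y)) a) z /\
  wirtinger c (fun y => pull (fun x e => J x e y) (fun b => W b (tau y)) a) z =
  \sum_e J c e z * pull (fun x e => J x e z)
                     (fun b => wirtinger e (W b) (tau z)) a +
  dpull (fun x e => wirtinger c (J x e) z) (fun x e => J x e z)
        (fun b => W b (tau z)) a.
Proof.
elim: a W => /= [|x a IH] W dW.
  split; first exact: cdiff_comp.
  by rewrite addr0 wirtinger_chain.
have dW' e b : cdiff (W (e :: b)) (tau z) by [].
have d1 e := proj1 (IH _ (dW' e)).
split; first by apply: cdiff_sum => e; exact: cdiffM.
rewrite wirtinger_sum; last by move=> e; exact: cdiffM.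
apply: etrans (eq_bigr _ (fun e _ => wirtingerM c (J_diff x e) (d1 e))) _.
under eq_bigr => e _ do rewrite (proj2 (IH _ (dW' e))).
under [X in _ = X + _]eq_bigr => e _ do rewrite mulr_sumr.
rewrite [X in _ = X + _]exchange_big -big_split; apply: eq_bigr => e _ /=.
under [X in _ = X + _]eq_bigr => f _ do rewrite mulrCA.
by rewrite -mulr_sumr; ring.
Qed.

(** Second derivatives of [tau] occur twice: in the derivative of the pullback along [c], and in the
    Leibniz terms of the tail. Both equal the same [dpull], with opposite signs. *)
Lemma ext_pull W a : (forall b, cdiff (W b) (tau z)) ->
  (forall y, skew (W^~ y)) ->
  ext P (fun a y => pull (fun c e => J c e y) (fun b => W b (tau y)) a) a z =
  pull (fun c e => J c e z) (fun b => ext P W b (tau z)) a.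
Proof.
elim: a W => //= c a IH W dW sW.
have dW' e b : cdiff (W (e :: b)) (tau z) by [].
have sW' e y : skew (fun b => W (e :: b) y) by exact: (@skew_cons _ _ _ e (sW y)).
rewrite ext_sum //; last first.
  by move=> e b; exact: (proj1 (pull_cdiff_wirtinger c b (dW' e))).
rewrite big_split /=.
(* [J_comm] exchanges the differentiating index [x] with [c]; [dpull_wedge] then recognizes the
   Leibniz terms. *)
have -> : \sum_e wedge (fun x => if P x then wirtinger x (J c e) z else 0)
     (fun b => pull (fun c e => J c e z) (fun b => W (e :: b) (tau z)) b) a =
   if P c then dpull (fun x e => wirtinger c (J x e) z) (fun x e => J x e z)
        (fun b => W b (tau z)) a else 0.
  rewrite (eq_bigr (fun e => wedge
      (fun x => if P c then wirtinger c (J x e) z else 0)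
      (fun b => pull (fun c e => J c e z) (fun b => W (e :: b) (tau z)) b) a));
    last by move=> e _; congr wedge; apply/funext => x; exact: J_comm.
  case: ifP => Pc; first by rewrite dpull_wedge.
  by rewrite big1 // => e _; exact: wedge0.
have -> : \sum_e J c e z * ext P (fun b y =>
      pull (fun c e => J c e y) (fun b => W (e :: b) (tau y)) b) a z =
    \sum_e J c e z * pull (fun c e => J c e z)
      (fun b => ext P (fun d => W (e :: d)) b (tau z)) a.
  by apply: eq_bigr => e _; rewrite (IH _ (dW' e) (sW' e)).
(* The test [P e] may be replaced by [P c], since by [J_pure] the factor [J c e z] vanishes when
   they differ. *)
have -> : \sum_e J c e z * pull (fun c e => J c e z)
      (fun b => (if P e then wirtinger e (W b) (tau z) else 0) -
                ext P (fun d => W (e :: d)) b (tau z)) a =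
    (if P c then \sum_e J c e z * pull (fun c e => J c e z)
                    (fun b => wirtinger e (W b) (tau z)) a else 0) -
    \sum_e J c e z * pull (fun c e => J c e z)
      (fun b => ext P (fun d => W (e :: d)) b (tau z)) a.
  rewrite (fun_if (fun x => x - _)) sub0r -!sumrN -big_split /=.
  have E e : J c e z * pull (fun c e => J c e z)
        (fun b => (if P e then wirtinger e (W b) (tau z) else 0) -
                  ext P (fun d => W (e :: d)) b (tau z)) a =
      J c e z * (if P c then pull (fun c e => J c e z)
                      (fun b => wirtinger e (W b) (tau z)) a else 0) -
      J c e z * pull (fun c e => J c e z)
        (fun b => ext P (fun d => W (e :: d)) b (tau z)) a.
    have [->|/J_pure ->] := eqVneq (P c) (P e); last by rewrite !mul0r subr0.
    rewrite pullB mulrBr; case: (P e) => //.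
    by rewrite pull0.
  rewrite (eq_bigr _ (fun e _ => E e)); case: (P c) => //.
  by apply: eq_bigr => e _; rewrite mulr0 sub0r.
case: (P c); last by ring.
by rewrite (proj2 (pull_cdiff_wirtinger c a dW)); ring.
Qed.

End Naturality.
End ExteriorDerivative.

(** * Transition maps and their complex Jacobians *)

Section Overlaps.
Variables (R : realType) (n : nat) (X : complexManifold R n).
Local Notation E := (cspace R n).
Local Notation C := R[i].
Local Notation I := (cindex n).
Implicit Types (i j : chart X) (z : E) (c e x : I).

Lemma overlap_img i j z : overlap i j z -> chart_img i z.
Proof. by move=> [p [pi _] <-]; exists p. Qed.

Lemma transition_img i j z : overlap i j z -> chart_img j (transition i j z).
Proof.
by move=> [p [pi pj] <-]; exists p => //; rewrite /transition /= chart_mapK.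
Qed.

Lemma overlap_open i j : open (overlap i j).
Proof.
have iO := @chart_img_open R n X i.
have inv_cont := @chart_inv_continuous R n X i.
have -> : overlap i j =
    chart_img i `&` chart_inv i @^-1` (chart_dom i `&` chart_dom j).
  apply/seteqP; split=> z /=.
    by move=> [p [pi pj] <-]; split; [exists p | rewrite /= chart_mapK].
  by move=> [[p pi <-]]; rewrite chart_mapK //; exists p.
rewrite (continuous_open_subspace _ iO) in inv_cont.
have /(continuous_inP _ iO) := inv_cont; apply.
by apply: openI; exact: chart_dom_open.
Qed.

Definition jac i j c e z : C :=
  wirtinger c (fun y => zcoord e (transition i j y)) z.

Lemma transition_smooth i j e :
  csmooth_on (overlap i j) (fun y => zcoord e (transition i j y)).
Proof.
have hol := transition_holomorphic (c := X) i j.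
case: e => k; first by have [] := hol k.
have Oo := @overlap_open i j; have [[s1 s2] _] := hol k.
split; first exact: s1.
have := smooth_lin Oo (-1) s2 (@smooth0 R n (overlap i j)).
by apply: smooth_eq => // y _; rewrite !fctE addr0 /= scaleN1r.
Qed.

Lemma transition_cdiff i j e z : overlap i j z ->
  cdiff (fun y => zcoord e (transition i j y)) z.
Proof. by move=> oz; apply: csmooth_cdiff oz; exact: transition_smooth. Qed.

Lemma jac_smooth i j c e : csmooth_on (overlap i j) (jac i j c e).
Proof.
by apply: csmooth_wirtinger; [exact: overlap_open | exact: transition_smooth].
Qed.

Lemma jac_bar i j c e z : overlap i j z ->
  jac i j (bar c) (bar e) z = conjc (jac i j c e z).
Proof.
move=> oz; rewrite /jac -[c in RHS]barK -wirtinger_conj; last exact: transition_cdiff.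
by apply: eq_wirtinger => y; rewrite zcoord_bar.
Qed.

(** One mixed block vanishes by the Cauchy-Riemann equations of the transition, the other is its
    conjugate by [jac_bar]. *)
Lemma jac_pure i j c e z : overlap i j z -> is_inl c != is_inl e ->
  jac i j c e z = 0.
Proof.
have hol := transition_holomorphic (c := X) i j.
move=> oz; case: c e => k [l|l] // _; last by have [_] := hol l; apply.
rewrite -[inl k]/(bar (inr k)) -[inr l]/(bar (inl l)) jac_bar //.
by have [_ h] := hol l; rewrite /jac h // conjc0.
Qed.

(* [del] and [delbar] are the two instances. *)
Definition type_pred (P : pred I) : Prop :=
  forall c e, P c != P e -> is_inl c != is_inl e.

(** If [P x = P c], this is the symmetry of second derivatives. Otherwise one of [x], [c] is of the
    type opposite to [e]; differentiating along it first gives zero near [z], so both mixed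
    derivatives vanish. *)
Lemma jac_comm P i j x c e z : type_pred P -> overlap i j z ->
  (if P x then wirtinger x (jac i j c e) z else 0) =
  (if P c then wirtinger c (jac i j x e) z else 0).
Proof.
move=> tP oz; have Oo := @overlap_open i j.
have nz : \near z, overlap i j z by exact: open_nbhs_nbhs.
have comm u v : wirtinger u (jac i j v e) z = wirtinger v (jac i j u e) z.
  exact: (wirtinger_comm Oo u v (transition_smooth i j e) oz).
have null u v : P v != P e -> wirtinger u (jac i j v e) z = 0.
  move=> ne; rewrite -[RHS](wirtinger_cst u 0 z); apply: near_eq_wirtinger.
  by apply: filterS nz => y oy; apply: jac_pure => //; exact: tP.
have mixed u v : P u != P v -> wirtinger u (jac i j v e) z = 0.
  move=> ne; have [Pve|] := eqVneq (P v) (P e); last exact: null.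
  by rewrite comm null // -Pve.
have [->|ne] := eqVneq (P x) (P c); first by rewrite comm.
by rewrite (mixed x c) // (mixed c x) 1?eq_sym // !if_same.
Qed.

End Overlaps.

(** * The partial exterior derivatives on global forms *)

Section FormCalculus.
Variables (R : realType) (n : nat) (X : complexManifold R n).
Local Notation E := (cspace R n).
Local Notation C := R[i].
Local Notation I := (cindex n).
Local Notation preform := (chart X -> E -> seq I -> C).
Implicit Types (i j : chart X) (z : E) (c e : I) (a : seq I) (w u v : preform).
Implicit Types (P Q : pred I) (r s k : int).

Definition comps w i : seq I -> E -> C := fun a y => w i y a.

Lemma partial_extE P w i z a : chart_img i z ->
  partial_ext P w i z a = ext P (comps w i) a z.
Proof. by move=> iz; rewrite /partial_ext mem_set // extE. Qed.

Lemma partial_ext_out P w i z a : ~ chart_img i z -> partial_ext P w i z a = 0.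
Proof. by move=> iz; rewrite /partial_ext memNset. Qed.

Lemma near_img i z : chart_img i z -> \near z, chart_img i z.
Proof. by move=> iz; exact/open_nbhs_nbhs/(conj (@chart_img_open R n X i)). Qed.

Lemma form_presmooth w : is_form w -> presmooth w. Proof. by case. Qed.

Lemma form_pull w i j z a : is_form w -> overlap i j z ->
  w i z a = pull (fun c e => jac i j c e z) (w j (transition i j z)) a.
Proof. by move=> fw oz; rewrite pull_tuple (form_compat fw _ oz). Qed.

Lemma presmooth_cdiff w i z a : presmooth w -> chart_img i z ->
  cdiff (comps w i a) z.
Proof. by move=> sw iz; apply: csmooth_cdiff iz; exact: sw. Qed.

(** Compatibility on overlaps is the substantial condition: there [w i] is the pullback of [w j],
    and [ext_pull] applies. *)
Lemma is_form_partial_ext P w : type_pred P -> is_form w ->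
  is_form (partial_ext P w).
Proof.
move=> tP fw; have sw := form_presmooth fw.
have skw i y : skew ((comps w i)^~ y).
  by move=> a1 b c a2; exact: form_skew fw _ _ _ _ _ _.
split.
- by move=> i z a; exact: partial_ext_out.
- exact: partial_ext_smooth.
- move=> i z a1 b c a2; have [iz|iz] := pselect (chart_img i z); last first.
    by rewrite !partial_ext_out // oppr0.
  rewrite !partial_extE //.
  by apply: (@skew_ext _ _ P (comps w i) z) => // d; exact: presmooth_cdiff.
- move=> i j z a oz.
  refine (etrans _ (pull_tuple (fun c e => jac i j c e z)
    (partial_ext P w j (transition i j z)) a)).
  rewrite partial_extE; last exact: overlap_img oz.
  have -> : pull (fun c e => jac i j c e z)
        (partial_ext P w j (transition i j z)) a =
      pull (fun c e => jac i j c e z)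
        (fun b => ext P (comps w j) b (transition i j z)) a.
    congr pull; apply/funext => b; apply: partial_extE.
    exact: transition_img oz.
  rewrite -[RHS]ext_pull.
  + apply: near_eq_ext => b.
    (* Derivatives are compared, so the pullback formula is needed on a neighbourhood of [z]; the
       overlap is open. *)
    have nz : \near z, overlap i j z.
      by apply: open_nbhs_nbhs; split => //; exact: overlap_open.
    by apply: filterS nz => y oy; exact: form_pull.
  + by move=> e; exact: transition_cdiff.
  + by move=> c e; apply: csmooth_cdiff oz; exact: jac_smooth.
  + by move=> x c e; exact: jac_comm.
  + by move=> c e ne; apply: jac_pure => //; exact: tP.
  + move=> b; apply: presmooth_cdiff => //; exact: transition_img oz.
  + exact: skw.
Qed.

Lemma type_pred_inl : type_pred (is_inl : pred I). Proof. by []. Qed.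
Lemma type_pred_inr : type_pred (predC is_inl : pred I).
Proof. by case=> ? [] ?. Qed.

Lemma is_form_del w : is_form w -> is_form (del w).
Proof. by apply: is_form_partial_ext; exact: type_pred_inl. Qed.

Lemma is_form_delbar w : is_form w -> is_form (delbar w).
Proof. by apply: is_form_partial_ext; exact: type_pred_inr. Qed.

Lemma partial_ext_anticomm P Q w : presmooth w ->
  partial_ext P (partial_ext Q w) = - partial_ext Q (partial_ext P w).
Proof.
move=> sw; apply/funext => i; apply/funext => z; apply/funext => a.
rewrite -[RHS]/(- partial_ext Q (partial_ext P w) i z a).
have [iz|iz] := pselect (chart_img i z); last first.
  by rewrite !partial_ext_out // oppr0.
have extK T T' : partial_ext T (partial_ext T' w) i z a =
    ext T (ext T' (comps w i)) a z.
  rewrite partial_extE //; apply: near_eq_ext => b.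
  by apply: filterS (near_img iz) => y iy; exact: partial_extE.
by rewrite !extK; apply: (ext_anticomm (@chart_img_open R n X i)) => // b; exact: sw.
Qed.

(** Anticommutation of the operator with itself gives v = -v, hence v = 0 in characteristic 0. *)
Lemma partial_ext_square P w : presmooth w -> partial_ext P (partial_ext P w) = 0.
Proof.
move=> sw; have := partial_ext_anticomm P P sw; set v := partial_ext _ _ => vN.
apply/funext => i; apply/funext => z; apply/funext => a.
have : v i z a = - v i z a by rewrite {1}vN.
by move/eqP; rewrite -addr_eq0 -mulr2n mulrn_eq0 => /eqP.
Qed.

End FormCalculus.

(** * Decomposition of forms by bidegree *)

Section Bidegree.
Variables (R : realType) (n : nat) (X : complexManifold R n).
Local Notation E := (cspace R n).
Local Notation C := R[i].
Local Notation I := (cindex n).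
Local Notation preform := (chart X -> E -> seq I -> C).
Implicit Types (i j : chart X) (z : E) (c e : I) (a : seq I) (w u v : preform).
Implicit Types (P Q : pred I) (r s k : int).

Lemma partial_extB P u v : presmooth u -> presmooth v ->
  partial_ext P (u - v) = partial_ext P u - partial_ext P v.
Proof.
move=> su sv; have := partial_ext_lin P (-1) sv su.
by rewrite !scaleN1r ![- _ + _]addrC.
Qed.

Lemma partial_ext0 P : partial_ext P (0 : preform) = 0.
Proof.
have s0 : presmooth (0 : preform) := form_presmooth (is_form0 X).
by have := partial_extB P s0 s0; rewrite !subr0 subrr.
Qed.

Lemma delB u v : presmooth u -> presmooth v -> del (u - v) = del u - del v.
Proof. exact: partial_extB. Qed.

Lemma delbarB u v : presmooth u -> presmooth v ->
  delbar (u - v) = delbar u - delbar v.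
Proof. exact: partial_extB. Qed.

Lemma del0 : del (0 : preform) = 0. Proof. exact: partial_ext0. Qed.

Lemma delbar0 : delbar (0 : preform) = 0. Proof. exact: partial_ext0. Qed.

Lemma del_del w : presmooth w -> del (del w) = 0.
Proof. exact: partial_ext_square. Qed.

Lemma delbar_delbar w : presmooth w -> delbar (delbar w) = 0.
Proof. exact: partial_ext_square. Qed.

Lemma delbar_del w : presmooth w -> delbar (del w) = - del (delbar w).
Proof. exact: partial_ext_anticomm. Qed.

Lemma is_formD u v : is_form u -> is_form v -> is_form (u + v).
Proof. by move=> fu fv; rewrite -[u]scale1r; exact: is_form_lin. Qed.

Lemma is_form_dext w : is_form w -> is_form (dext w).
Proof.
by move=> fw; apply: is_formD; [exact: is_form_del | exact: is_form_delbar].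
Qed.

Lemma dextB u v : is_form u -> is_form v -> dext (u - v) = dext u - dext v.
Proof.
move=> /form_presmooth su /form_presmooth sv.
by rewrite /dext (delB su sv) (delbarB su sv) opprD addrACA.
Qed.

Lemma dextD u v : is_form u -> is_form v -> dext (u + v) = dext u + dext v.
Proof.
move=> /form_presmooth su /form_presmooth sv.
by have := dext_lin 1 su sv; rewrite !scale1r.
Qed.

Lemma dext_dext w : is_form w -> dext (dext w) = 0.
Proof.
move=> fw; have sw := form_presmooth fw.
have s1 := form_presmooth (is_form_del fw).
have s2 := form_presmooth (is_form_delbar fw).
have lin P : partial_ext P (del w + delbar w) =
    partial_ext P (del w) + partial_ext P (delbar w).
  by have := partial_ext_lin P 1 s1 s2; rewrite !scale1r.
rewrite /dext [del (_ + _)]lin [delbar (_ + _)]lin -!/(del _) -!/(delbar _).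
by rewrite del_del // delbar_delbar // delbar_del // add0r addr0 subrr.
Qed.

Definition has_type r s a : bool :=
  ((count is_inl a)%:Z == r) && ((count (predC is_inl) a)%:Z == s).

(** The types are integers, so that a negative one gives the zero form; the descents below start
    from such a type. *)
Definition proj r s w : preform :=
  fun i z a => if has_type r s a then w i z a else 0.

Lemma count_omit (p : pred I) a (l : 'I_(size a)) :
  count p a = (count p (take l a ++ drop l.+1 a) + p (tnth (in_tuple a) l))%N.
Proof.
have x0 := tnth (in_tuple a) l.
rewrite -[in LHS](cat_take_drop l a) (drop_nth x0) // !count_cat /=.
by rewrite (tnth_nth x0) /=; lia.
Qed.

Lemma has_type_omit_inl r s a (l : 'I_(size a)) : is_inl (tnth (in_tuple a) l) ->
  has_type (r + 1) s a = has_type r s (take l a ++ drop l.+1 a).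
Proof.
move=> lP; rewrite /has_type (count_omit is_inl l) (count_omit (predC is_inl) l).
by rewrite /= lP addn0; lia.
Qed.

Lemma has_type_omit_inr r s a (l : 'I_(size a)) :
  ~~ is_inl (tnth (in_tuple a) l) ->
  has_type r (s + 1) a = has_type r s (take l a ++ drop l.+1 a).
Proof.
move=> lP; rewrite /has_type (count_omit is_inl l) (count_omit (predC is_inl) l).
by rewrite /= (negPf lP) addn0; lia.
Qed.

(** By hypothesis all summands of the component [a] come from index lists that pass the mask exactly
    when [a] does. *)
Lemma proj_partial_ext P r s r' s' w :
  (forall a (l : 'I_(size a)), P (tnth (in_tuple a) l) ->
     has_type r' s' a = has_type r s (take l a ++ drop l.+1 a)) ->
  proj r' s' (partial_ext P w) = partial_ext P (proj r s w).
Proof.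
move=> h; apply/funext => i; apply/funext => z; apply/funext => a.
rewrite /proj /partial_ext; have [_|_] := boolP (z \in _); last exact: if_same.
case: ifP => Ta; first by apply: eq_bigr => l lP; rewrite -(h _ _ lP) Ta.
by rewrite big1 // => l lP; rewrite -(h _ _ lP) Ta wirtinger_cst mulr0.
Qed.

Lemma proj_del r s w : proj (r + 1) s (del w) = del (proj r s w).
Proof. by apply: proj_partial_ext => a l; exact: has_type_omit_inl. Qed.

Lemma proj_delbar r s w : proj r (s + 1) (delbar w) = delbar (proj r s w).
Proof. by apply: proj_partial_ext => a l; exact: has_type_omit_inr. Qed.

Lemma projD r s u v : proj r s (u + v) = proj r s u + proj r s v.
Proof.
apply/funext => i; apply/funext => z; apply/funext => a.
rewrite -[RHS]/(proj r s u i z a + proj r s v i z a) /proj.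
by case: ifP; rewrite ?addr0.
Qed.

Lemma projB r s u v : proj r s (u - v) = proj r s u - proj r s v.
Proof.
apply/funext => i; apply/funext => z; apply/funext => a.
rewrite -[RHS]/(proj r s u i z a - proj r s v i z a) /proj.
by case: ifP; rewrite ?subr0.
Qed.

Lemma proj0 r s : proj r s 0 = 0.
Proof. by have := projB r s 0 0; rewrite !subr0 subrr. Qed.

Lemma proj_dext r s w :
  proj r s (dext w) = del (proj (r - 1) s w) + delbar (proj r (s - 1) w).
Proof.
by rewrite projD -proj_del -proj_delbar !subrK.
Qed.

Lemma has_typeP r s a : reflect
  ((count is_inl a)%:Z = r /\ (count (predC is_inl) a)%:Z = s) (has_type r s a).
Proof. by apply: (iffP andP) => -[/eqP ? /eqP ?]. Qed.

Lemma proj_id r s w : rsform r s w -> proj r s w = w.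
Proof.
move=> [_ h]; apply/funext => i; apply/funext => z; apply/funext => a.
by rewrite /proj; case: has_typeP => // /h.
Qed.

Lemma proj_rsform r s w : is_form w -> proj r s w = w -> rsform r s w.
Proof.
move=> fw h; split=> // i z a /has_typeP; rewrite -[w in LHS]h /proj.
by case: ifP.
Qed.

(** Compatibility on overlaps holds because holomorphic transitions preserve types: [jac_pure] is
    the hypothesis of [pull_mask]. *)
Lemma rsform_proj r s w : is_form w -> rsform r s (proj r s w).
Proof.
move=> fw; apply: proj_rsform; last first.
  apply/funext => i; apply/funext => z; apply/funext => a.
  by rewrite /proj; case: (has_type r s a).
split.
- by move=> i z a iz; rewrite /proj (form_supp fw) // if_same.
- move=> i a; rewrite /proj; case: (has_type r s a); last exact: csmooth0.
  exact: form_smooth fw i a.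
- move=> i z a1 b c a2; rewrite /proj (form_skew fw).
  have -> : has_type r s (a1 ++ b :: c :: a2) = has_type r s (a1 ++ c :: b :: a2).
    have swap (p : pred I) : count p (a1 ++ b :: c :: a2) = count p (a1 ++ c :: b :: a2).
      by rewrite !count_cat /= [(p b + _)%N]addnCA.
    by rewrite /has_type !swap.
  by case: ifP; rewrite ?oppr0.
- move=> i j z a oz.
  pose T (t : seq bool) := ((count id t)%:Z == r) && ((count negb t)%:Z == s).
  have hT b : has_type r s b = T (map is_inl b) by rewrite /T !count_map.
  refine (etrans _ (pull_tuple (fun c e => jac i j c e z)
    (proj r s w j (transition i j z)) a)).
  rewrite /proj hT (form_pull _ fw oz).
  rewrite -(@pull_mask _ _ (is_inl : I -> bool)); last first.
    by move=> c e; exact: jac_pure.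
  by congr pull; apply/funext => b; rewrite hT.
Qed.

Lemma rsform_del r s w : rsform r s w -> rsform (r + 1) s (del w).
Proof.
move=> h; have [fw _] := h; apply: proj_rsform; first exact: is_form_del.
by rewrite proj_del proj_id.
Qed.

Lemma rsform_delbar r s w : rsform r s w -> rsform r (s + 1) (delbar w).
Proof.
move=> h; have [fw _] := h; apply: proj_rsform; first exact: is_form_delbar.
by rewrite proj_delbar proj_id.
Qed.

Lemma rsformB r s u v : rsform r s u -> rsform r s v -> rsform r s (u - v).
Proof. by move=> fu fv; rewrite addrC -scaleN1r; exact: rsform_lin. Qed.

Lemma kformB k u v : kform k u -> kform k v -> kform k (u - v).
Proof. by move=> fu fv; rewrite addrC -scaleN1r; exact: kform_lin. Qed.

Lemma kformD k u v : kform k u -> kform k v -> kform k (u + v).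
Proof. by move=> fu fv; rewrite -[u]scale1r; exact: kform_lin. Qed.

Lemma rsform_kform r s w : rsform r s w -> kform (r + s) w.
Proof.
move=> [fw h]; split=> // i z a sa; apply: h => -[h1 h2]; apply: sa.
by rewrite -h1 -h2 -(count_predC is_inl a).
Qed.

Lemma proj_disjoint r s r' s' w : rsform r s w -> (r', s') <> (r, s) ->
  proj r' s' w = 0.
Proof.
move=> [_ h] ne; apply/funext => i; apply/funext => z; apply/funext => a.
rewrite /proj; case: has_typeP => // -[h1 h2]; apply: h => -[h3 h4].
by apply: ne; rewrite -h1 -h2 h3 h4.
Qed.

Lemma proj_kform k r s w : kform k w -> r + s <> k -> proj r s w = 0.
Proof.
move=> [_ h] ne; apply/funext => i; apply/funext => z; apply/funext => a.
rewrite /proj; case: has_typeP => // -[h1 h2]; apply: h => sa; apply: ne.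
by rewrite -h1 -h2 -sa -(count_predC is_inl a).
Qed.

Lemma proj_neg r s w : r < 0 -> proj r s w = 0.
Proof.
move=> r0; apply/funext => i; apply/funext => z; apply/funext => a.
by rewrite /proj; case: has_typeP => // -[h1 h2]; lia.
Qed.

Lemma rsform_proj_eq0 r s w : is_form w ->
  (forall r' s', (r', s') <> (r, s) -> proj r' s' w = 0) -> rsform r s w.
Proof.
move=> fw h; split=> // i z a ne.
(* Projecting to the type of [a] itself leaves the component at [a] unchanged. *)
have /(congr1 (fun w : preform => w i z a)) :
    proj (count is_inl a)%:Z (count (predC is_inl) a)%:Z w = 0.
  by apply: h => -[h1 h2]; apply: ne.
by rewrite /proj /has_type !eqxx.
Qed.

Lemma kform_dext k w : kform k w -> kform (k + 1) (dext w).
Proof.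
move=> kw; have [fw _] := kw; split; first exact: is_form_dext.
move=> i z a sa.
have /(congr1 (fun w : preform => w i z a)) :
    proj (count is_inl a)%:Z (count (predC is_inl) a)%:Z (dext w) = 0.
  have cs := count_predC is_inl a.
  by rewrite proj_dext !(proj_kform kw) ?del0 ?delbar0 ?addr0 //; lia.
by rewrite /proj /has_type !eqxx.
Qed.

End Bidegree.

(** * Complex conjugation of forms *)

Section Conjugation.
Variables (R : realType) (n : nat) (X : complexManifold R n).
Local Notation E := (cspace R n).
Local Notation C := R[i].
Local Notation I := (cindex n).
Local Notation preform := (chart X -> E -> seq I -> C).
Implicit Types (i j : chart X) (z : E) (c e : I) (a : seq I) (w u v : preform).
Implicit Types (P Q : pred I) (r s k : int).

(** Conjugation sends dz_j to dzbar_j, hence [bar] on the indices besides [conjc] on the values. *)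
Definition conj_form w : preform := fun i z a => conjc (w i z (map (@bar n) a)).

Lemma conj_formK : involutive conj_form.
Proof.
move=> w; apply/funext => i; apply/funext => z; apply/funext => a.
by rewrite /conj_form conjcK (mapK (@barK n)).
Qed.

Lemma conj_formB u v : conj_form (u - v) = conj_form u - conj_form v.
Proof.
apply/funext => i; apply/funext => z; apply/funext => a.
exact: (rmorphB (@conjc R)).
Qed.

Lemma conj_formD u v : conj_form (u + v) = conj_form u + conj_form v.
Proof.
apply/funext => i; apply/funext => z; apply/funext => a.
exact: (rmorphD (@conjc R)).
Qed.

Lemma conj_form0 : conj_form 0 = 0.
Proof. by have := conj_formB 0 0; rewrite !subr0 subrr. Qed.

Lemma ext_conj P (W : seq I -> E -> C) a z : (forall b, cdiff (W b) z) ->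
  ext P (fun b y => conjc (W (map (@bar n) b) y)) a z =
  conjc (ext (fun c => P (bar c)) W (map (@bar n) a) z).
Proof.
elim: a W => [|c a IH] W dW; first exact/esym/conjc0.
rewrite [LHS]/= [ext _ _ _ z in RHS]/= (IH (fun b => W (bar c :: b))) //.
rewrite rmorphB barK; congr (_ - _).
by case: (P c); [exact: wirtinger_conj | exact/esym/conjc0].
Qed.

Lemma partial_ext_conj P w : presmooth w ->
  partial_ext P (conj_form w) = conj_form (partial_ext (fun c => P (bar c)) w).
Proof.
move=> sw; apply/funext => i; apply/funext => z; apply/funext => a.
rewrite /conj_form; have [iz|iz] := pselect (chart_img i z); last first.
  by rewrite !partial_ext_out //; exact/esym/conjc0.
rewrite !partial_extE //.
by apply: (ext_conj P (W := comps w i)) => b; exact: presmooth_cdiff.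
Qed.

Lemma del_conj w : presmooth w -> del (conj_form w) = conj_form (delbar w).
Proof.
move=> sw; rewrite /del partial_ext_conj //; congr (conj_form (partial_ext _ _)).
by apply/funext; case.
Qed.

Lemma delbar_conj w : presmooth w -> delbar (conj_form w) = conj_form (del w).
Proof.
move=> sw; rewrite /delbar partial_ext_conj //; congr (conj_form (partial_ext _ _)).
by apply/funext; case.
Qed.

Lemma dext_conj w : presmooth w -> dext (conj_form w) = conj_form (dext w).
Proof. by move=> sw; rewrite /dext del_conj // delbar_conj // conj_formD addrC. Qed.

Lemma pull_conj (J : I -> I -> C) (W : seq I -> C) a :
  (forall c e, J (bar c) (bar e) = conjc (J c e)) ->
  pull J (fun b => conjc (W (map (@bar n) b))) a =
  conjc (pull J W (map (@bar n) a)).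
Proof.
move=> JE; elim: a W => //= c a IH W.
rewrite rmorph_sum (reindex_inj (inv_inj (@barK n))); apply: eq_bigr => e _ /=.
rewrite [RHS]rmorphM; congr (_ * _).
  by apply: etrans (JE (bar c) e); rewrite barK.
apply: etrans (IH (fun b => W (e :: b))); congr (pull J _ a).
by apply/funext => b; rewrite barK.
Qed.

Lemma is_form_conj w : is_form w -> is_form (conj_form w).
Proof.
move=> fw; split.
- by move=> i z a iz; rewrite /conj_form (form_supp fw) //; exact: conjc0.
- move=> i a; have [s1 s2] := form_smooth fw i (map (@bar n) a).
  have iO := @chart_img_open R n X i; split.
    by apply: smooth_eq s1 => // z _; rewrite /conj_form; case: (w _ _ _).
  apply: smooth_eq (smooth_lin iO (-1) s2 (@smooth0 R n (chart_img i))) => // z _.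
  by rewrite !fctE addr0 scaleN1r /conj_form; case: (w _ _ _).
- move=> i z a1 b c a2; rewrite /conj_form !map_cat /= (form_skew fw).
  exact: (rmorphN (@conjc R)).
- move=> i j z a oz.
  refine (etrans _ (pull_tuple (fun c e => jac i j c e z)
    (conj_form w j (transition i j z)) a)).
  rewrite /conj_form (form_pull _ fw oz) pull_conj // => c e.
  exact: jac_bar.
Qed.

Lemma has_type_bar r s a : has_type r s (map (@bar n) a) = has_type s r a.
Proof.
rewrite /has_type !count_map andbC.
by congr ((_%:Z == _) && (_%:Z == _)); apply: eq_count; case.
Qed.

Lemma proj_conj r s w : proj r s (conj_form w) = conj_form (proj s r w).
Proof.
apply/funext => i; apply/funext => z; apply/funext => a.
by rewrite /conj_form /proj has_type_bar; case: ifP; rewrite ?conjc0.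
Qed.

Lemma rsform_conj r s w : rsform r s w -> rsform s r (conj_form w).
Proof.
move=> h; have [fw _] := h; apply: proj_rsform; first exact: is_form_conj.
by rewrite proj_conj proj_id.
Qed.

Lemma kform_conj k w : kform k w -> kform k (conj_form w).
Proof.
move=> [fw h]; split; first exact: is_form_conj.
by move=> i z a sa; rewrite /conj_form h ?conjc0 // size_map.
Qed.

End Conjugation.

(** * Maps of subquotients induced by inclusions *)

Section InducedMap.
Variables (K : nzRingType) (V : lmodType K) (Z1 B1 Z2 B2 : submodClosed V).
Hypotheses (Z12 : {subset Z1 <= Z2}) (B12 : {subset B1 <= B2}).

Definition cocycle_incl (x : cocycle Z1) : cocycle Z2 := Cocycle (Z12 (valP x)).

Definition induced (x : subquot Z1 B1) : subquot Z2 B2 :=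
  class_of B2 (cocycle_incl (repr x)).

Lemma induced_class (x : cocycle Z1) :
  induced (class_of B1 x) = class_of B2 (cocycle_incl x).
Proof.
have xB : \val (repr (class_of B1 x)) - \val x \in B1.
  by apply/class_ofE; rewrite class_ofK.
exact/class_ofE/B12.
Qed.

Lemma induced_linear : linear induced.
Proof.
move=> c x y; rewrite -[x]class_ofK -[y]class_ofK !induced_class.
rewrite -[c *: class_of _ _]class_ofZ -[c *: class_of _ _]class_ofZ -!class_ofD.
rewrite induced_class; congr class_of; exact: val_inj.
Qed.

(** The two hypotheses state injectivity and surjectivity on representatives, so that only forms
    have to be handled later. *)
Lemma induced_iso :
  (forall x, x \in Z1 -> x \in B2 -> x \in B1) ->
  (forall x, x \in Z2 -> exists2 y, y \in Z1 & x - y \in B2) ->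
  exists f : {linear subquot Z1 B1 -> subquot Z2 B2}, bijective f /\
    forall x : cocycle Z1, exists2 x' : cocycle Z2,
      \val x' = \val x & f (class_of B1 x) = class_of B2 x'.
Proof.
move=> inj surj.
pose fL := GRing.isLinear.Build _ _ _ _ _ induced_linear.
pose f : {linear subquot Z1 B1 -> subquot Z2 B2} := HB.pack induced fL.
exists f; split; last first.
  by move=> x; exists (cocycle_incl x) => //; exact: induced_class.
have f_surj y : exists x, f x = y.
  rewrite -[y]class_ofK; have [x xZ xB] := surj _ (valP (repr y)).
  exists (class_of B1 (Cocycle xZ)); apply: etrans (induced_class _) _.
  by apply/esym/class_ofE.
have f_inj : injective f.
  move=> x y; rewrite -[x]class_ofK -[y]class_ofK => fxy.
  apply/class_ofE; apply: inj; first exact: (valP (repr x - repr y)).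
  by apply/(@class_ofE _ _ Z2 B2 (cocycle_incl _) (cocycle_incl _));
    rewrite -!induced_class.
(* The inverse selects preimages by choice. *)
pose g y := sval (cid (f_surj y)).
have gK y : f (g y) = y by exact: svalP (cid (f_surj y)).
by exists g => // x; apply: f_inj; rewrite gK.
Qed.

End InducedMap.

(** * Vanishing dimensions *)

Section Dimension.
Variable R : realType.
Local Notation C := R[i].

Lemma cdim_ge0 (V : lmodType C) : (0 <= cdim V)%E.
Proof.
apply: ereal_sup_ubound; exists 0%N => //=.
by exists (fun=> 0) => c _ [].
Qed.

(** A nonzero vector is an independent family of length 1, which would make the supremum at least
    1. *)
Lemma cdim_eq0 (V : lmodType C) : cdim V = 0%E -> forall v : V, v = 0.
Proof.
move=> V0 v; apply/eqP/negP => /negP v0.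
have : (1%:E <= cdim V)%E.
  apply: ereal_sup_ubound; exists 1%N => //=; exists (fun=> v) => c.
  rewrite big_ord1 => /eqP; rewrite scaler_eq0 (negPf v0) orbF => /eqP c0 k.
  by rewrite ord1.
by rewrite V0 lee_fin ler10.
Qed.

Lemma double_sume_eq0 m1 m2 (P : 'I_m1 -> 'I_m2 -> bool)
    (F : 'I_m1 -> 'I_m2 -> \bar R) : (forall r s, 0 <= F r s)%E ->
  (\sum_(r < m1) \sum_(s < m2 | P r s) F r s)%E = 0%E ->
  forall r s, P r s -> F r s = 0%E.
Proof.
move=> F0 /eqP; rewrite seq_psume_eq0 => [|r _]; last exact: sume_ge0.
move=> /allP h r s Prs; have /= := h r (mem_index_enum r).
rewrite seq_psume_eq0 // => /allP /(_ s (mem_index_enum s)).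
by rewrite Prs => /eqP.
Qed.

End Dimension.

(** * Inductions on the bidegree *)

Section Descent.
Variables (R : realType) (n : nat) (X : complexManifold R n).
Local Notation E := (cspace R n).
Local Notation C := R[i].
Local Notation preform := (chart X -> E -> seq (cindex n) -> C).
Implicit Types (w u v alpha beta : preform).

Definition delbar_exact (r s : int) : Prop := forall w : preform,
  rsform r s w -> delbar w = 0 -> exists2 u, rsform r (s - 1) u & delbar u = w.

Lemma dolbeault_exact (r s : int) : cdim (dolbeault X r s) = 0%E -> delbar_exact r s.
Proof.
move=> /cdim_eq0 H0 w rw dw.
have wZ : w \in @dolbeault_ker R n X r s by apply/asboolP.
have : class_of (@dolbeault_im R n X r s) (Cocycle wZ) =
       class_of (@dolbeault_im R n X r s) 0.
  exact: etrans (H0 _) (esym (H0 _)).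
move/class_ofE => /asboolP[u ru du]; exists u => //.
by rewrite du; exact: subr0.
Qed.

(** At each stage [del u] corrects the next component of [beta] into a [delbar]-closed form without
    changing its image under [del]. *)
Lemma del_component_exact (h k : nat) beta :
  (forall r s : nat, (r + s).+1 = (h + k)%N -> (k <= s)%N -> delbar_exact r s) ->
  is_form beta -> rsform h k (dext beta) ->
  exists2 u, rsform (h%:Z - 1) (k%:Z - 1) u &
    del (proj (h%:Z - 1) k beta) = del (delbar u).
Proof.
move=> ex fb dbt.
(* Stage [j] treats the type (j - 1, h + k - j): it starts at the zero component with r = -1 and
   reaches (h - 1, k) for [j = h]. *)
suff descent (j : nat) : (j <= h)%N ->
    exists2 u, rsform (j%:Z - 1) ((h + k)%N%:Z - j%:Z - 1) u &
    del (proj (j%:Z - 1) ((h + k)%N%:Z - j%:Z) beta) = del (delbar u).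
  have [u ru du] := descent h (leqnn h).
  have hk : (h + k)%N%:Z - h%:Z = k by lia.
  by rewrite hk in ru du; exists u.
elim: j => [|j IH] jh.
  exists 0; first exact: rsform0.
  by rewrite proj_neg // delbar0.
have [u ru du] := IH (ltnW jh).
have fu : is_form u by case: ru.
pose s : nat := (h + k - j.+1)%N.
have sE : (h + k)%N%:Z - j.+1%:Z = s by rewrite /s; lia.
have jE : j.+1%:Z - 1 = j by lia.
rewrite sE jE.
have fB : is_form (proj j s beta) by case: (rsform_proj j s fb).
have rdu : rsform j s (del u).
  have := rsform_del ru; rewrite subrK.
  by have -> : (h + k)%N%:Z - j%:Z - 1 = s by rewrite /s; lia.
have fdu : is_form (del u) by case: rdu.
(* As [j < h], the form [dext beta] has no component of type (j, s + 1); this component is the sum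
   of [delbar (proj j s beta)] and of [del] of the preceding component, equal to
   [del (delbar u)]. *)
have dB : delbar (proj j s beta - del u) = 0.
  rewrite (delbarB (form_presmooth fB) (form_presmooth fdu)).
  rewrite (delbar_del (form_presmooth fu)) opprK.
  have : proj j (s%:Z + 1) (dext beta) = 0.
    by apply: proj_disjoint dbt _ => -[]; lia.
  rewrite proj_dext addrK addrC.
  by have <- : (h + k)%N%:Z - j%:Z = s%:Z + 1 by [rewrite /s; lia]; rewrite du.
have jsE : (j + s).+1 = (h + k)%N by rewrite /s; lia.
have ks : (k <= s)%N by rewrite /s; lia.
have [v rv dv] := ex j s jsE ks _ (rsformB (rsform_proj j s fb) rdu) dB.
exists v; first exact: rv.
rewrite dv (delB (form_presmooth fB) (form_presmooth fdu)).
by rewrite (del_del (form_presmooth fu)) subr0.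
Qed.

(** The components are removed in increasing order of [r]. The condition on the types of [b] matters
    when the lemma is applied to a conjugate form: it ensures that the second correction does not
    restore the types removed by the first. *)
Lemma kill_small_types (h k : nat) alpha :
  (forall r s : nat, (r + s)%N = (h + k)%N -> (k < s)%N -> delbar_exact r s) ->
  kform (h + k)%N alpha -> dext alpha = 0 ->
  exists b, [/\ kform ((h + k)%N%:Z - 1) b,
    forall r s : int, s < k%:Z -> proj r s b = 0 &
    forall r s : int, r < h%:Z -> proj r s (alpha - dext b) = 0].
Proof.
move=> ex ka da.
suff descent (j : nat) : (j <= h)%N ->
  exists b, [/\ kform ((h + k)%N%:Z - 1) b,
    forall r s : int, s < k%:Z -> proj r s b = 0 &
    forall r s : int, r < j%:Z -> proj r s (alpha - dext b) = 0].
  exact: descent.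
elim: j => [|j IH] jh.
  exists 0; split=> [|r s _|r s r0]; [exact: kform0 | exact: proj0 |].
  exact: proj_neg.
have [b [kb b0 ab0]] := IH (ltnW jh).
have fb : is_form b by case: kb.
have fa : is_form alpha by case: ka.
have kdb : kform (h + k)%N (dext b) by have := kform_dext kb; rewrite subrK.
have kab := kformB ka kdb; have fab : is_form (alpha - dext b) by case: kab.
pose s : nat := (h + k - j)%N.
pose c := proj j s (alpha - dext b).
have rc : rsform j s c by exact: rsform_proj.
(* In the (j, s + 1) component of the closed form [alpha - dext b], the contribution of [del]
   vanishes because no component with [r < j] is left. *)
have dc : delbar c = 0.
  have : proj j (s%:Z + 1) (dext (alpha - dext b)) = 0.
    rewrite dextB // ?da ?dext_dext ?subr0 ?proj0 //; exact: is_form_dext.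
  rewrite proj_dext addrK ab0; last by lia.
  by rewrite del0 add0r.
have jsE : (j + s)%N = (h + k)%N by rewrite /s; lia.
have ks : (k < s)%N by rewrite /s; lia.
have [u ru du] := ex j s jsE ks _ rc dc.
have fu : is_form u by case: ru.
have ku : kform ((h + k)%N%:Z - 1) u.
  have := rsform_kform ru.
  by have -> : j%:Z + (s%:Z - 1) = (h + k)%N%:Z - 1 by rewrite /s; lia.
exists (b + u); split; first exact: kformD.
  move=> r s' s'k; rewrite projD b0 // add0r; apply: proj_disjoint ru _ => -[].
  by rewrite /s; lia.
move=> r s' rj.
have -> : alpha - dext (b + u) = alpha - dext b - del u - delbar u.
  by rewrite (dextD fb fu) opprD addrA -[RHS]addrA -opprD.
rewrite projB projB.
(* Subtracting [delbar u = c] removes the component (j, s), while [del u] only affects [r = j + 1],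
   which later stages treat. *)
have -> : proj r s' (del u) = 0.
  by apply: proj_disjoint (rsform_del ru) _ => -[]; lia.
rewrite subr0 du; have [rlt|rge] := ltP r j%:Z.
  by rewrite ab0 // (proj_disjoint rc) ?subr0 // => -[]; lia.
have rE : r = j by lia.
rewrite rE; have [->|ne] := eqVneq s' s%:Z; first by rewrite (proj_id rc) subrr.
rewrite (proj_disjoint rc) ?subr0; last by move=> -[] /eqP; rewrite (negPf ne).
by apply: (proj_kform kab) => H; move/eqP: ne; rewrite /s; lia.
Qed.

End Descent.

(** * The map from Bott-Chern to de Rham cohomology on representatives *)

Section Comparison.
Variables (R : realType) (n : nat) (X : complexManifold R n) (h k : nat).
Local Notation E := (cspace R n).
Local Notation C := R[i].
Local Notation preform := (chart X -> E -> seq (cindex n) -> C).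
Implicit Types (w alpha beta : preform).
Local Notation N := (h + k)%N.

Lemma bottChern_dR_ker alpha :
  alpha \in @bottChern_ker R n X h k -> alpha \in @deRham_ker R n X N.
Proof.
move=> /asboolP[ra da dba]; apply/asboolP; split.
  by rewrite PoszD; exact: rsform_kform.
by rewrite /dext da dba addr0.
Qed.

(** Since [delbar] squares to zero, [del (delbar u)] is [dext (delbar u)]. *)
Lemma bottChern_dR_im alpha :
  alpha \in @bottChern_im R n X h k -> alpha \in @deRham_im R n X N.
Proof.
move=> /asboolP[u ru <-]; apply/asboolP; exists (delbar u).
  have := rsform_kform (rsform_delbar ru).
  by have -> : h%:Z - 1 + (k%:Z - 1 + 1) = N%:Z - 1 by lia.
have su : presmooth u by case: ru => /form_presmooth.
by rewrite /dext delbar_delbar // addr0.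
Qed.

Hypothesis exact_pred : forall r s : nat, (r + s).+1 = N ->
  (minn h k <= s)%N -> @delbar_exact R n X r s.

Lemma bottChern_dR_inj alpha : alpha \in @bottChern_ker R n X h k ->
  alpha \in @deRham_im R n X N -> alpha \in @bottChern_im R n X h k.
Proof.
move=> /asboolP[ra _ _] /asboolP[beta kb db]; apply/asboolP.
have fb : is_form beta by case: kb.
(* The bound [minn h k] lies below both [k] and [h], so the same vanishing serves [beta] and its
   conjugate. *)
have ex1 (r s : nat) : (r + s).+1 = (h + k)%N -> (k <= s)%N ->
    @delbar_exact R n X r s by move=> rs ks; apply: exact_pred; lia.
have ex2 (r s : nat) : (r + s).+1 = (k + h)%N -> (h <= s)%N ->
    @delbar_exact R n X r s by move=> rs hs; apply: exact_pred; lia.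
have rdb : rsform h k (dext beta) by rewrite db.
have [u ru du] := del_component_exact ex1 fb rdb.
have rdcb : rsform k h (dext (conj_form beta)).
  by rewrite (dext_conj (form_presmooth fb)); exact: rsform_conj.
have [v rv dv] := del_component_exact ex2 (is_form_conj fb) rdcb.
have fv : is_form v by case: rv.
have fu : is_form u by case: ru.
have rcv : rsform (h%:Z - 1) (k%:Z - 1) (conj_form v) by exact: rsform_conj.
exists (u - conj_form v); first exact: rsformB.
have fcv := is_form_conj fv.
have dbB := delbarB (form_presmooth fu) (form_presmooth fcv).
have dB := delB (form_presmooth (is_form_delbar fu))
  (form_presmooth (is_form_delbar fcv)).
have sp r s : presmooth (proj r s beta) by have [/form_presmooth] := rsform_proj r s fb.
(* Conjugating [dv] yields [delbar (del (conj_form v))] on the right; anticommutation brings the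
   sign, which explains the witness [u - conj_form v]. *)
have {}dv : delbar (proj h (k%:Z - 1) beta) = - del (delbar (conj_form v)).
  have := congr1 (@conj_form R n X) dv.
  rewrite proj_conj del_conj // conj_formK => ->.
  rewrite -delbar_conj; last exact/form_presmooth/is_form_delbar.
  rewrite -del_conj; last exact: form_presmooth.
  exact: delbar_del (form_presmooth (is_form_conj fv)).
by rewrite dbB dB -du -dv -proj_dext db proj_id.
Qed.

Hypothesis exact_top : forall r s : nat, (r + s)%N = N ->
  (minn h k < s)%N -> @delbar_exact R n X r s.

(** A first correction removes the components with [r < h]; a second one, computed on the conjugate,
    removes those with [s < k]. In total degree h + k only the type (h, k) survives. *)
Lemma bottChern_dR_surj alpha : alpha \in @deRham_ker R n X N ->
  exists2 w, w \in @bottChern_ker R n X h k & alpha - w \in @deRham_im R n X N.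
Proof.
move=> /asboolP[ka da]; have fa : is_form alpha by case: ka.
have ex1 (r s : nat) : (r + s)%N = (h + k)%N -> (k < s)%N ->
    @delbar_exact R n X r s by move=> rs ks; apply: exact_top; lia.
have ex2 (r s : nat) : (r + s)%N = (k + h)%N -> (h < s)%N ->
    @delbar_exact R n X r s by move=> rs hs; apply: exact_top; lia.
have [b [kb b0 ab0]] := kill_small_types ex1 ka da.
have fb : is_form b by case: kb.
have kab : kform N (alpha - dext b).
  by apply: kformB => //; have := kform_dext kb; rewrite subrK.
have fab : is_form (alpha - dext b) by case: kab.
have dab : dext (alpha - dext b) = 0.
  by rewrite dextB ?da ?dext_dext ?subr0 //; exact: is_form_dext.
have kcab : kform (k + h)%N (conj_form (alpha - dext b)).
  by rewrite addnC; exact: kform_conj.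
have dcab : dext (conj_form (alpha - dext b)) = 0.
  by rewrite (dext_conj (form_presmooth fab)) dab conj_form0.
have [c [kc c0 cab0]] := kill_small_types ex2 kcab dcab.
rewrite addnC in kc.
have fc : is_form c by case: kc.
have kcc := kform_conj kc; have fcc := is_form_conj fc.
pose w := alpha - dext b - dext (conj_form c).
have kw : kform N w.
  by apply: kformB => //; have := kform_dext kcc; rewrite subrK.
have fw : is_form w by case: kw.
have dw : dext w = 0.
  by rewrite dextB ?dab ?dext_dext ?subr0 //; exact: is_form_dext.
(* By [c0], the form [conj_form c] has only components with [r >= h], and so does its
   differential. *)
have w_r r s : r < h%:Z -> proj r s w = 0.
  move=> rh; rewrite projB ab0 // proj_dext !proj_conj !c0 ?conj_form0; try lia.
  by rewrite del0 delbar0 addr0 subr0.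
have w_s r s : s < k%:Z -> proj r s w = 0.
  move=> sk; rewrite -[w]conj_formK proj_conj conj_formB.
  rewrite -dext_conj ?conj_formK ?cab0 ?conj_form0 //; exact: form_presmooth.
have rw : rsform h k w.
  apply: rsform_proj_eq0 => // r s ne.
  have [/w_r //|hr] := ltP r h%:Z; have [/w_s //|ks] := ltP s k%:Z.
  by apply: (proj_kform kw) => rs; apply: ne; congr (_, _); lia.
(* For [w] of pure type, [del w] and [delbar w] are the components (h + 1, k) and (h, k + 1) of
   [dext w]. *)
have closed_component r s : proj r s (dext w) = 0 by rewrite dw proj0.
exists w.
  apply/asboolP; split=> //.
    have := closed_component (h%:Z + 1) k%:Z.
    rewrite proj_dext addrK (proj_id rw) (proj_disjoint rw); last by case; lia.
    by rewrite delbar0 addr0.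
  have := closed_component h%:Z (k%:Z + 1).
  rewrite proj_dext addrK (proj_id rw) (proj_disjoint rw); last by case; lia.
  by rewrite del0 add0r.
apply/asboolP; exists (b + conj_form c); first exact: kformD.
by rewrite (dextD fb fcc) /w -[alpha - _ - _]addrA -[- _ - _]opprD subKr.
Qed.

End Comparison.

Theorem corollary3p2 (R : realType) (n : nat) (X : complexManifold R n)
    (p q : nat) (p_gt0 : (0 < p)%N) (q_gt0 : (0 < q)%N) :
  (\sum_(r < p + q) \sum_(s < p + q
      | (r + s == (p + q).-1)%N && (minn p q <= s)%N)
      cdim (dolbeault X r%:Z s%:Z))%E = 0%E /\
  (\sum_(r < (p + q).+1) \sum_(s < (p + q).+1
      | (r + s == p + q)%N && ((minn p q).+1 <= s)%N)
      cdim (dolbeault X r%:Z s%:Z))%E = 0%E ->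
  forall h k : nat, (0 < h)%N -> (0 < k)%N -> (h + k = p + q)%N ->
    (minn p q <= h <= maxn p q)%N -> (minn p q <= k <= maxn p q)%N ->
  exists f : {linear bottChern X h%:Z k%:Z -> deRham X (p + q)%N%:Z},
    bijective f /\ induced_by_identity f.
Proof.
move=> [van1 van2] h k h0 k0 hk hm km.
have {}van1 := double_sume_eq0 (fun r s => cdim_ge0 _) van1.
have {}van2 := double_sume_eq0 (fun r s => cdim_ge0 _) van2.
(* The bounds on [h] and [k] give [minn p q <= minn h k], so each group required for (h, k) is a
   summand of a vanishing sum. *)
have ex1 (r s : nat) : (r + s).+1 = (h + k)%N -> (minn h k <= s)%N ->
    @delbar_exact R n X r s.
  move=> rs ms; apply: dolbeault_exact.
  have rp : (r < p + q)%N by lia.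
  have sp : (s < p + q)%N by lia.
  by apply: (van1 (Ordinal rp) (Ordinal sp)) => /=; lia.
have ex2 (r s : nat) : (r + s)%N = (h + k)%N -> (minn h k < s)%N ->
    @delbar_exact R n X r s.
  move=> rs ms; apply: dolbeault_exact.
  have rp : (r < (p + q).+1)%N by lia.
  have sp : (s < (p + q).+1)%N by lia.
  by apply: (van2 (Ordinal rp) (Ordinal sp)) => /=; lia.
rewrite -hk.
exact: (induced_iso (@bottChern_dR_ker R n X h k) (@bottChern_dR_im R n X h k)
  (bottChern_dR_inj ex1) (bottChern_dR_surj ex2)).
Qed.
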